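(* Let $1\le p<\infty$ and $n\ge1$. The identification $\ell^p(\mathbb N^n)=\ell^p\big(\mathbb N;\ell^p(\mathbb N^{n-1})\big)$ and slicewise action give, for bounded linear operators $T_1,\dots,T_n$ on $\ell^p$, $$\|T_1\otimes\cdots\otimes T_n\|\le\prod_{i=1}^n\|T_i\|$$ on coordinate norms (i.e. $T_1\otimes\cdots\otimes T_n$ acts on $\ell^p(\mathbb N^n)$ with operator norm at most $\prod_i\|T_i\|$). The coordinate $\ell^p$-norm is a uniform reasonable crossnorm, exact on elementary tensors: $\|(x_iy_j)\|_{\ell^p(\mathbb N^2)}=\|x\|_p\,\|y\|_p$. Consequently, for bounded $T$ on $\ell^p$, $\|\Lambda^nT\|\le\|T\|^n$ up to the normalization constant between subset- and tuple-indexing, and the Plücker embedding is $\mathrm{GL}(\ell^p)$-equivariant with this quantitative control.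
   Context: Scalars are complex. The coordinate norm on $n$-fold tensors of $\ell^p=\ell^p(\mathbb N)$ is the norm of $\ell^p(\mathbb N^n)$, with $x^{(1)}\otimes\cdots\otimes x^{(n)}$ identified with $\big(\prod_r x^{(r)}_{i_r}\big)_{(i_1,\dots,i_n)}$. Let $\mathcal I_n=\binom{\mathbb N}{n}$ be the set of $n$-element subsets of $\mathbb N$. The coordinate norm on the $n$-th exterior power is the $\ell^p(\mathcal I_n)$-norm of the coordinates with respect to $e_{i_1}\wedge\cdots\wedge e_{i_n}$, $i_1<\dots<i_n$ (subset-indexing); alternatively one uses the $\ell^p(\mathbb N^n)$-norm of the alternating extension of the coordinates to ordered tuples (tuple-indexing). $\Lambda^nT$ is the induced operator on the exterior power, $v_1\wedge\cdots\wedge v_n\mapsto Tv_1\wedge\cdots\wedge Tv_n$. The Plücker embedding sends an $n$-dimensional subspace $V=\operatorname{span}(v_1,\dots,v_n)\subset\ell^p$ to the class of $v_1\wedge\cdots\wedge v_n$, i.e. of $(p_I)_{I\in\mathcal I_n}$ with $p_I=\det(v_r(i_s))$, in $\mathbb P(\ell^p(\mathcal I_n))$. A crossnorm is reasonable if it and its dual norm equal the product of norms on elementary tensors, and uniform if tensor products of bounded operators are bounded with norm at most the product of the norms. *)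

(* Defs.v *)
From HB Require Import structures.
From mathcomp Require Import all_boot all_order all_algebra all_fingroup finmap.
From mathcomp Require Import complex.
From mathcomp Require Import all_classical all_reals all_analysis.

Set Implicit Arguments.
Unset Strict Implicit.
Unset Printing Implicit Defensive.

Import Order.TTheory GRing.Theory Num.Theory.

Local Open Scope classical_set_scope.
Local Open Scope ring_scope.

Notation cmod := (@ComplexField.Normc.normc _).

Section ExtendedNorm.
Context {R : realType} (p : R) {I : choiceType}.
Implicit Types (a : I -> \bar R) (x y : I -> R[i]).

(* For a of nonnegative terms: the norm of l^p(I; X) when a i is the norm in X
   of the i-th coordinate. *)
Definition lpsum a : \bar R :=
  ((\esum_(i in [set: I]) a i `^ p) `^ p^-1)%E.

Definition lpnorme x : \bar R := lpsum (fun i => (cmod (x i))%:E).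

End ExtendedNorm.

Section LpMem.
Context {R : realType} (p : R) (hp : 1 <= p).
Local Open Scope ereal_scope.

Let p_gt0 : (0 < p)%R. Proof. exact: lt_le_trans hp. Qed.

Lemma cmod_ge0 (z : R[i]) : (0 <= cmod z)%R.
Proof. by case: z => a b; rewrite /= sqrtr_ge0. Qed.

Lemma lpnorme_lty (I : choiceType) (x : I -> R[i]) :
  (lpnorme p x < +oo) = (\esum_(i in [set: I]) ((cmod (x i)) `^ p)%:E < +oo).
Proof.
rewrite /lpnorme /lpsum; under eq_esum do rewrite poweR_EFin.
apply/idP/idP; last exact: poweR_lty.
by apply: lty_poweRy; rewrite invr_neq0// gt_eqF.
Qed.

Lemma esum_leMl (I : choiceType) (c : R) (f : I -> \bar R) :
  (0 <= c)%R -> (forall i, 0 <= f i) ->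
  \esum_(i in [set: I]) (c%:E * f i) <= c%:E * \esum_(i in [set: I]) f i.
Proof.
move=> c0 f0; apply: ge_ereal_sup => _ [A [fA _] <-].
rewrite -ge0_mule_fsumr//; apply: lee_pmul => //.
  by apply: fsume_ge0.
by apply: ereal_sup_ubound; exists A.
Qed.

Lemma lpmem_inj (I J : choiceType) (f : J -> I) (x : I -> R[i]) :
  injective f -> lpnorme p x < +oo -> lpnorme p (x \o f) < +oo.
Proof.
move=> fi; rewrite !lpnorme_lty; apply: le_lt_trans.
rewrite -(@esum_image _ _ _ [set: J] f (fun i => ((cmod (x i)) `^ p)%:E)).
  rewrite [leRHS](esumID (f @` [set: J])) ?setTI; last first.
    by move=> i _; rewrite lee_fin powR_ge0.
  by rewrite leeDl// esum_ge0// => i _; rewrite lee_fin powR_ge0.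
by move=> i j _ _ /fi.
Qed.

Lemma cmodD (z w : R[i]) : (cmod (z + w) <= cmod z + cmod w)%R.
Proof. by have := ler_normD z w; rewrite -lecR rmorphD. Qed.

Lemma lpmem_lin (I : choiceType) (c : R[i]) (x y : I -> R[i]) :
  lpnorme p x < +oo -> lpnorme p y < +oo ->
  lpnorme p (fun i => c * x i + y i)%R < +oo.
Proof.
rewrite !lpnorme_lty => xoo yoo.
pose F i := ((cmod c `^ p)%:E * (cmod (x i) `^ p)%:E + (cmod (y i) `^ p)%:E).
apply: (@le_lt_trans _ _
    (\esum_(i in [set: I]) ((2 `^ p)%:E * F i))).
  apply: le_esum => i _; rewrite /F -EFinM. rewrite lee_fin.
  rewrite -powRM ?cmod_ge0// -ComplexField.Normc.normcM.
  apply: (@le_trans _ _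
      ((2 * Num.max (cmod (c * x i)) (cmod (y i))) `^ p)%R).
    apply: ge0_ler_powR; rewrite ?nnegrE ?cmod_ge0//; first exact: ltW.
      by rewrite mulr_ge0// le_max cmod_ge0.
    apply: le_trans (cmodD _ _) _.
    by rewrite mulr_natl mulr2n lerD// le_max lexx ?orbT.
  rewrite powRM ?le_max ?cmod_ge0//; apply: ler_wpM2l; first exact: powR_ge0.
  by case: (leP _ (cmod (y i))) => _; rewrite ?lerDl ?lerDr powR_ge0.
have p0 z : (0 <= (cmod z `^ p)%:E :> \bar R) by rewrite lee_fin powR_ge0.
apply: le_lt_trans (esum_leMl _ _) _.
- exact: powR_ge0.
- by move=> i; rewrite /F adde_ge0// mule_ge0.
rewrite lte_mul_pinfty ?lee_fin ?powR_ge0// /F esumD; last 2 first.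
- by move=> i _; rewrite mule_ge0.
- by [].
rewrite lte_add_pinfty//.
apply: le_lt_trans (esum_leMl _ _) _ => //; first exact: powR_ge0.
by rewrite lte_mul_pinfty// lee_fin powR_ge0.
Qed.

Lemma lpmem0 (I : choiceType) : lpnorme p (fun _ : I => 0%R) < +oo.
Proof.
rewrite lpnorme_lty esum1 ?ltry// => i _.
by rewrite ComplexField.Normc.normc0 powR0// gt_eqF.
Qed.

Lemma lpmem_tens (n : nat) (x : 'I_n -> nat -> R[i]) :
  (forall r, lpnorme p (x r) < +oo) ->
  lpnorme p (fun t : n.-tuple nat => \prod_r x r (tnth t r))%R < +oo.
Proof.
move=> xoo; rewrite lpnorme_lty.
pose P r := (fine (\esum_(i in [set: nat]) ((cmod (x r i)) `^ p)%:E)).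
have PE r : \esum_(i in [set: nat]) ((cmod (x r i)) `^ p)%:E = (P r)%:E.
  rewrite fineK// ge0_fin_numE -?lpnorme_lty// esum_ge0// => i _.
  by rewrite lee_fin powR_ge0.
apply: (@le_lt_trans _ _ (\prod_r P r)%:E); last exact: ltry.
apply: ge_ereal_sup => _ [A [fA _] <-].
rewrite fsbig_finite//= sumEFin lee_fin.
set s := enum_fset _.
have us : uniq s by exact: fset_uniq.
pose M := (\max_(t <- s) \max_(r < n) tnth t r)%N.
have tM t r : t \in s -> (tnth t r < M.+1)%N.
  move=> ts; rewrite ltnS /M (big_rem t)//= leq_max; apply/orP; left.
  exact: (@leq_bigmax _ (fun r : 'I_n => tnth t r) r).
pose h (t : n.-tuple nat) := [ffun r => inord (tnth t r) : 'I_M.+1].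
pose G (f : {ffun 'I_n -> 'I_M.+1}) := (\prod_r (cmod (x r (f r)) `^ p))%R.
have G0 f : (0 <= G f)%R by apply: prodr_ge0 => r _; exact: powR_ge0.
have hi : {in s &, injective h}.
  move=> t u ts us' /ffunP htu; apply: eq_from_tnth => r.
  have := congr1 val (htu r).
  by rewrite !ffunE /= !inordK// ?tM.
have -> : (\sum_(t <- s) (cmod (\prod_r x r (tnth t r))) `^ p =
          \sum_(f <- map h s) G f)%R.
  rewrite big_map; apply: eq_big_seq => t ts; rewrite /G.
  under [RHS]eq_bigr do rewrite ffunE inordK ?tM//.
  apply: (big_morph (fun z : R[i] => cmod z `^ p)%R) => [z w|].
    by rewrite ComplexField.Normc.normcM powRM ?cmod_ge0.
  by rewrite ComplexField.Normc.normc1 powR1.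
rewrite big_uniq/=; last by rewrite map_inj_in_uniq.
rewrite -[leRHS]/(\prod_r P r)%R.
apply: (@le_trans _ _ (\sum_f G f)%R).
  by rewrite [leRHS](bigID (mem (map h s)))/= lerDl sumr_ge0.
rewrite /G -(bigA_distr_bigA (fun r (j : 'I_M.+1) => cmod (x r j) `^ p)%R).
apply: ler_prod => r _; rewrite sumr_ge0/= => [|j _]; last exact: powR_ge0.
rewrite -lee_fin -PE -sumEFin (fsbig_ord _ _ (fun j => (cmod (x r j) `^ p)%:E)).
by apply: ereal_sup_ubound; exists `I_M.+1 => //; split => //; exact: finite_II.
Qed.

End LpMem.

Section Lp.
Context {R : realType} {p : R}.

Definition lp_pred (hp : 1 <= p) (I : choiceType) : {pred I -> R[i]} :=
  [pred x | (lpnorme p x < +oo)%E].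

Fact lp_submod_closed (hp : 1 <= p) (I : choiceType) :
  submod_closed (lp_pred hp (I := I)).
Proof.
split=> [|c x y]; rewrite !inE; first exact: lpmem0.
exact: lpmem_lin.
Qed.

HB.instance Definition _ (hp : 1 <= p) (I : choiceType) :=
  GRing.isSubmodClosed.Build R[i] (I -> R[i]) (lp_pred hp (I := I))
    (lp_submod_closed hp I).

(* The proof hp is a parameter because l^p is a vector space only for suitable
   exponents. *)
Record lp (hp : 1 <= p) (I : choiceType) : Type := Lp {
  lpval :> I -> R[i];
  lpvalP : lpval \in lp_pred hp (I := I) }.

HB.instance Definition _ (hp : 1 <= p) (I : choiceType) :=
  [isSub for @lpval hp I].
HB.instance Definition _ (hp : 1 <= p) (I : choiceType) :=
  [Choice of lp hp I by <:].
HB.instance Definition _ (hp : 1 <= p) (I : choiceType) :=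
  [SubChoice_isSubLmodule of lp hp I by <:].

Definition lpnorm {hp : 1 <= p} {I : choiceType} (x : lp hp I) : R :=
  fine (lpnorme p x).

End Lp.

Section Operators.
Context {R : realType}.

Definition is_norm (V : lmodType R[i]) (N : V -> R) : Prop :=
  [/\ forall u v, N (u + v) <= N u + N v,
      forall (c : R[i]) u, N (c *: u) = cmod c * N u
    & forall u, N u = 0 -> u = 0].

Definition op_bounded (V W : Type) (N : V -> R) (M : W -> R) (T : V -> W) :
    Prop :=
  exists C : R, forall x, M (T x) <= C * N x.

(* Meaningful for bounded T only: the infimum of the empty set is 0. *)
Definition opnorm (V W : Type) (N : V -> R) (M : W -> R) (T : V -> W) : R :=
  inf [set C : R | 0 <= C /\ forall x, M (T x) <= C * N x].

End Operators.

Section Tensors.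
Context {R : realType} {p : R} (hp : 1 <= p) (n : nat).
Implicit Types (x : 'I_n -> lp hp nat).

Fact tens_subproof x :
  (fun t : n.-tuple nat => \prod_r x r (tnth t r))
    \in lp_pred hp (I := n.-tuple nat).
Proof. exact: (lpmem_tens hp (x := x) (fun r => lpvalP (x r))). Qed.

Definition tens x : lp hp (n.-tuple nat) := Lp (tens_subproof x).

(* The algebraic n-fold tensor power of l^p, realized (faithfully) in l^p(N^n)
   as the linear span of the elementary tensors. *)
Definition atens_pred : {pred lp hp (n.-tuple nat)} :=
  [pred u | `[< exists s : seq (R[i] * ('I_n -> lp hp nat)),
                  u = \sum_(cx <- s) cx.1 *: tens cx.2 >]].

Fact atens_submod_closed : submod_closed atens_pred.
Proof.
split=> [|c u v]; rewrite !inE; first by exists [::]; rewrite big_nil.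
move=> [s ->] [t ->]; exists ([seq (c * cx.1, cx.2) | cx <- s] ++ t).
rewrite big_cat big_map/= scaler_sumr; congr (_ + _).
by apply: eq_bigr => i _; rewrite scalerA.
Qed.

HB.instance Definition _ :=
  GRing.isSubmodClosed.Build R[i] (lp hp (n.-tuple nat)) atens_pred
    atens_submod_closed.

Record atens : Type := ATens {
  atval :> lp hp (n.-tuple nat);
  atvalP : atval \in atens_pred }.

HB.instance Definition _ := [isSub for atval].
HB.instance Definition _ := [Choice of atens by <:].
HB.instance Definition _ := [SubChoice_isSubLmodule of atens by <:].

Fact atens_elt_subproof x : tens x \in atens_pred.
Proof. by rewrite inE; exists [:: (1, x)]; rewrite big_seq1 scale1r. Qed.

Definition atens_elt x : atens := ATens (atens_elt_subproof x).

Definition coord_norm (u : atens) : R := lpnorm u.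

Definition reasonable_crossnorm (N : atens -> R) : Prop :=
  [/\ is_norm N,
      forall x, N (atens_elt x) = \prod_r lpnorm (x r)
    & forall phi : 'I_n -> {linear lp hp nat -> R[i]},
        (forall r, op_bounded lpnorm cmod (phi r)) ->
        exists Phi : {linear atens -> R[i]},
          [/\ forall x, Phi (atens_elt x) = \prod_r phi r (x r),
              op_bounded N cmod Phi
            & opnorm N cmod Phi =
                \prod_r opnorm lpnorm cmod (phi r)]].

Definition uniform_norm (N : atens -> R) : Prop :=
  forall T : 'I_n -> {linear lp hp nat -> lp hp nat},
    (forall r, op_bounded lpnorm lpnorm (T r)) ->
    exists S : {linear atens -> atens},
      [/\ forall x, S (atens_elt x) = atens_elt (fun r => T r (x r)),
          op_bounded N N S
        & opnorm N N S <=
            \prod_r opnorm lpnorm lpnorm (T r)].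

Definition tensor_op (T : 'I_n -> lp hp nat -> lp hp nat)
    (S : lp hp (n.-tuple nat) -> lp hp (n.-tuple nat)) : Prop :=
  op_bounded lpnorm lpnorm S
  /\ forall x, S (tens x) = tens (fun r => T r (x r)).

Definition put (k : 'I_n) (t : n.-tuple nat) (j : nat) : n.-tuple nat :=
  [tuple if r == k then j else tnth t r | r < n].

Fact fiber_subproof (k : 'I_n) (t : n.-tuple nat) (u : lp hp (n.-tuple nat)) :
  (fun j => u (put k t j)) \in lp_pred hp (I := nat).
Proof.
rewrite inE; apply: (lpmem_inj hp (f := put k t)); last exact: (lpvalP u).
by move=> i j /(congr1 (fun s => tnth s k)); rewrite !tnth_mktuple eqxx.
Qed.

(* The slice of u through t in the k-th direction. *)
Definition fiber (k : 'I_n) (t : n.-tuple nat) (u : lp hp (n.-tuple nat)) :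
  lp hp nat := Lp (fiber_subproof k t u).

Definition slicewise (k : 'I_n) (T : lp hp nat -> lp hp nat)
    (A : lp hp (n.-tuple nat) -> lp hp (n.-tuple nat)) : Prop :=
  forall u t, A u t = T (fiber k t u) (tnth t k).

End Tensors.

Section ExteriorPower.
Context {R : realType} {p : R} (hp : 1 <= p) (n : nat).

Definition nsubset : choiceType := {I : {fset nat} | #|` I|%fset == n}.

(* elem I s is i_s, where I = {i_0 < ... < i_(n-1)}. *)
Definition elem (I : nsubset) (s : 'I_n) : nat :=
  nth 0%N (sort leq (enum_fset (val I))) s.

Lemma size_elem (I : nsubset) : size (sort leq (enum_fset (val I))) = n.
Proof. by rewrite size_sort; have /eqP := valP I. Qed.

Lemma elem_inj (I : nsubset) : injective (elem I).
Proof.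
move=> r s /eqP; rewrite nth_uniq ?size_elem// ?sort_uniq ?fset_uniq//.
by move=> /eqP/val_inj.
Qed.

Lemma mem_elem (I : nsubset) (i : nat) :
  reflect (exists s, i = elem I s) (i \in val I).
Proof.
have -> : (i \in val I) = (i \in sort leq (enum_fset (val I))).
  by rewrite mem_sort.
apply: (iffP (nthP 0%N)) => [[k]|[s ->]].
  by rewrite size_elem => kn <-; exists (Ordinal kn).
by exists s; rewrite ?size_elem.
Qed.

Lemma elemE_inj : injective elem.
Proof.
move=> I J IJ; apply/val_inj/fsetP => i.
by apply/mem_elem/mem_elem => -[s ->]; exists s; rewrite IJ.
Qed.

Implicit Types (v : 'I_n -> lp hp nat) (w : lp hp nsubset).

Fact wedge_subproof v :
  (fun I : nsubset => \det (\matrix_(r, s) v r (elem I s)))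
    \in lp_pred hp (I := nsubset).
Proof.
pose f (s : 'S_n) (I : nsubset) : n.-tuple nat := [tuple elem I (s r) | r < n].
have -> : (fun I : nsubset => \det (\matrix_(r, s) v r (elem I s))) =
    \sum_(s : 'S_n) ((-1) ^+ s : R[i]) *: (tens v \o f s).
  apply/funext => I; rewrite /determinant fct_sumE; apply: eq_bigr => s _.
  rewrite /= scalrfctE; congr (_ * _); apply: eq_bigr => r _.
  by rewrite mxE tnth_mktuple.
apply: rpred_sum => s _; apply: rpredZ; rewrite inE.
apply: (lpmem_inj hp); last exact: (lpvalP (tens v)).
move=> I J /= fIJ; apply: elemE_inj; apply/funext => r.
have := congr1 (fun t => tnth t (s^-1%g r)) fIJ.
by rewrite !tnth_mktuple permKV.
Qed.

(* v_1 /\ ... /\ v_n, with coordinates the Pluecker coordinates p_I. *)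
Definition wedge v : lp hp nsubset := Lp (wedge_subproof v).

Definition ext_power (T : lp hp nat -> lp hp nat)
    (L : lp hp nsubset -> lp hp nsubset) : Prop :=
  op_bounded lpnorm lpnorm L
  /\ forall v, L (wedge v) = wedge (fun r => T (v r)).

(* The alternating extension to ordered tuples. If t has distinct entries,
   exactly one permutation s sorts it and the sum is +- w J, with J the
   set of entries of t; otherwise that set does not have n elements. *)
Definition altext (w : nsubset -> R[i]) (t : n.-tuple nat) : R[i] :=
  if (insub [fset i | i in tval t]%fset : option nsubset) is Some J then
    \sum_(s : 'S_n | [forall r, tnth t (s r) == elem J r]) (-1) ^+ s * w J
  else 0.

Lemma altext_perm (w : nsubset -> R[i]) (I : nsubset) (s : 'S_n) :
  altext w [tuple elem I (s r) | r < n] = (-1) ^+ s * w I.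
Proof.
rewrite /altext; set t := mktuple _.
have tI : [fset i | i in tval t]%fset = val I.
  apply/fsetP => i; rewrite !inE/=.
  apply/(tnthP t)/mem_elem => [[r ->]|[r ->]].
    by exists (s r); rewrite tnth_mktuple.
  by exists (s^-1%g r); rewrite tnth_mktuple permKV.
rewrite tI valK (big_pred1 s^-1%g) ?odd_permV// => q /=.
apply/forallP/eqP => [h|-> r]; last by rewrite tnth_mktuple permKV.
apply/permP => r; apply: (@perm_inj _ s); rewrite permKV.
by have /eqP := h r; rewrite tnth_mktuple => /elem_inj.
Qed.

Lemma altext_nuniq (w : nsubset -> R[i]) (t : n.-tuple nat) :
  ~~ uniq t -> altext w t = 0.
Proof.
move=> nut; rewrite /altext; case: insubP => // I /eqP h _; case/negP: nut.
apply: (@leq_size_uniq _ (enum_fset [fset i | i in tval t]%fset)).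
- exact: fset_uniq.
- by move=> i; rewrite [_ \in _](_ : _ = (i \in [fset i | i in tval t]%fset))// !inE.
- by rewrite size_tuple -[in leqLHS]h.
Qed.

Definition tuple_norm w : R := fine (lpnorme p (altext w)).

Definition lin_span v : set (lp hp nat) :=
  [set x | exists c : 'I_n -> R[i], x = \sum_r c r *: v r].

Definition is_basis (V : set (lp hp nat)) v : Prop :=
  (forall c : 'I_n -> R[i], \sum_r c r *: v r = 0 -> forall r, c r = 0)
  /\ V = lin_span v.

Definition has_dim (V : set (lp hp nat)) : Prop := exists v, is_basis V v.

(* The class of w != 0 in the projective space, as the line through w. *)
Definition proj_class w : set (lp hp nsubset) :=
  [set u | exists c : R[i], u = c *: w].

Definition plucker (V : set (lp hp nat)) : set (lp hp nsubset) :=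
  [set u | exists2 v, is_basis V v & proj_class (wedge v) u].

End ExteriorPower.

Arguments has_dim {R p hp} n V.
Arguments plucker {R p hp} n V.
Arguments coord_norm {R p hp n} u.
Arguments tuple_norm {R p hp n} w.

(* Main.v *)
(* T_1 (x) ... (x) T_n is the composition of the n operators applying T_k on
   each line in direction k; summing over the lines, each of them has norm at
   most ||T_k||, for every p and without duality.  Finitely supported sequences
   are dense and are spanned by the e_I, so bounded operators agreeing on
   elementary tensors (or on wedges) are equal.  In particular the n-th tensor
   power of T commutes with the permutations of the coordinates; it thus
   preserves the alternating extensions of functions on n-subsets, where it is
   Lambda^n T.  Every n-subset has n! orderings, so that extending multiplies
   all norms by the same factor (n!)^(1/p), which cancels in the bound. *)
From HB Require Import structures.
Require Import Defs.
From mathcomp Require Import all_boot all_order all_algebra all_fingroup finmap.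
From mathcomp Require Import complex.
From mathcomp Require Import all_classical all_reals all_analysis.
From mathcomp Require Import ring.

Set Implicit Arguments.
Unset Strict Implicit.
Unset Printing Implicit Defensive.

Import Order.TTheory GRing.Theory Num.Theory.

Local Open Scope classical_set_scope.
Local Open Scope ring_scope.

(** * Scaling and rearranging unordered sums *)

Section Esum.
Context {R : realType}.
Local Open Scope ereal_scope.

(** The inequality opposite to [esum_leMl] is [esum_leMl] itself for the factor [c^-1] and the
    family [c * f]; the case [c = 0] is separate. *)
Lemma esumZl (I : choiceType) (c : R) (f : I -> \bar R) :
  (0 <= c)%R -> (forall i, 0 <= f i) ->
  \esum_(i in [set: I]) (c%:E * f i) = c%:E * \esum_(i in [set: I]) f i.
Proof.
move=> c0 f0; apply/eqP; rewrite eq_le esum_leMl//=.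
have [->|cn0] := eqVneq c 0%R.
  by rewrite mul0e esum_ge0// => i; rewrite mul0e.
have {c0}cp : (0 < c)%R by rewrite lt_neqAle eq_sym cn0.
rewrite -lee_pdivlMl//.
have {1}-> : f = fun i => c^-1%:E * (c%:E * f i).
  by apply/funext => i; rewrite muleA -EFinM mulVf// mul1e.
apply: esum_leMl; first by rewrite invr_ge0 ltW.
by move=> i; rewrite mule_ge0// lee_fin ltW.
Qed.

Lemma esum_bij (I J : choiceType) (e : I -> J) (a : J -> \bar R) :
  bijective e ->
  \esum_(j in [set: J]) a j = \esum_(i in [set: I]) a (e i).
Proof.
case=> e' eK e'K; apply: reindex_esum; split => //.
- by move=> i j _ _ /(can_inj eK).
- by move=> j _; exists (e' j).
Qed.

Lemma esum_pair (I J : choiceType) (a : I -> J -> \bar R) :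
  (forall i j, 0 <= a i j) ->
  \esum_(k in [set: I * J]) a k.1 k.2 =
  \esum_(i in [set: I]) \esum_(j in [set: J]) a i j.
Proof.
move=> a0; rewrite esum_esum//; congr (esum _ _).
by apply/seteqP; split => // -[].
Qed.

End Esum.

(** * The norm of [lp] through its [p]-th power *)

Section Energy.
Context {R : realType} {p : R} (hp : 1 <= p).
Local Open Scope ereal_scope.

(** The [p]-th power of [lpnorme]. Unlike the norm it is additive over a partition of the indices,
    and it makes sense before summability is known. *)
Definition lpe (I : choiceType) (x : I -> R[i]) : \bar R :=
  \esum_(i in [set: I]) (cmod (x i) `^ p)%:E.

Lemma exponent_gt0 : (0 < p)%R. Proof. exact: lt_le_trans hp. Qed.
Lemma exponent_neq0 : (p != 0)%R. Proof. by rewrite gt_eqF// exponent_gt0. Qed.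
Lemma lpe_ge0 (I : choiceType) (x : I -> R[i]) : 0 <= lpe x.
Proof. by apply: esum_ge0 => i _; rewrite lee_fin powR_ge0. Qed.

Lemma poweRVK (a : \bar R) : 0 <= a -> (a `^ p^-1) `^ p = a.
Proof. by move=> a0; rewrite -poweRrM mulVf ?exponent_neq0// poweRe1. Qed.

Lemma powRK (a : R) : (0 <= a)%R -> ((a `^ p) `^ p^-1 = a)%R.
Proof. by move=> a0; rewrite -powRrM divff ?exponent_neq0// powRr1. Qed.

Lemma lpnormeE (I : choiceType) (x : I -> R[i]) : lpnorme p x = lpe x `^ p^-1.
Proof. by []. Qed.

Lemma lpnorme_poweR (I : choiceType) (x : I -> R[i]) :
  lpnorme p x `^ p = lpe x.
Proof. by rewrite lpnormeE poweRVK// lpe_ge0. Qed.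

Lemma lpnorme_lp (I : choiceType) (x : lp hp I) : lpnorme p x = (lpnorm x)%:E.
Proof.
rewrite /lpnorm fineK// ge0_fin_numE; last exact: poweR_ge0.
exact: lpvalP.
Qed.

Lemma lpnorm_ge0 (I : choiceType) (x : lp hp I) : (0 <= lpnorm x)%R.
Proof. by rewrite fine_ge0// poweR_ge0. Qed.

Lemma lpe_lp (I : choiceType) (x : lp hp I) : lpe x = (lpnorm x `^ p)%:E.
Proof. by rewrite -lpnorme_poweR lpnorme_lp. Qed.

Lemma ler_powR2 (a b : R) :
  (0 <= a)%R -> (0 <= b)%R -> (a `^ p <= b `^ p)%R = (a <= b)%R.
Proof.
move=> a0 b0; apply/idP/idP => ab; last first.
  by apply: ge0_ler_powR; rewrite ?nnegrE// ltW// exponent_gt0.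
rewrite -(powRK a0) -(powRK b0).
by apply: ge0_ler_powR; rewrite ?nnegrE ?powR_ge0// invr_ge0 ltW// exponent_gt0.
Qed.

Lemma lpnorm_leM (I J : choiceType) (C : R) (x : lp hp I) (y : lp hp J) :
  (0 <= C)%R -> (lpnorm x <= C * lpnorm y)%R = (lpe x <= (C `^ p)%:E * lpe y).
Proof.
move=> C0; rewrite !lpe_lp -EFinM lee_fin -powRM ?lpnorm_ge0// ler_powR2//.
  exact: lpnorm_ge0.
by rewrite mulr_ge0 ?lpnorm_ge0.
Qed.

Lemma lpE (I : choiceType) (x y : lp hp I) : (forall i, x i = y i) -> x = y.
Proof. by move=> xy; apply/val_inj/funext. Qed.

Lemma lpD (I : choiceType) (x y : lp hp I) i : (x + y)%R i = (x i + y i)%R.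
Proof. by []. Qed.

Lemma lpN (I : choiceType) (x : lp hp I) i : (- x)%R i = (- x i)%R.
Proof. by []. Qed.

Lemma lpZ (I : choiceType) (c : R[i]) (x : lp hp I) i :
  (c *: x)%R i = (c * x i)%R.
Proof. by []. Qed.

Lemma lp0 (I : choiceType) i : (0 : lp hp I)%R i = 0%R.
Proof. by []. Qed.

Lemma lp_sum (I : choiceType) (K : Type) (s : seq K) (P : pred K)
    (F : K -> lp hp I) i :
  (\sum_(k <- s | P k) F k)%R i = (\sum_(k <- s | P k) F k i)%R.
Proof. by elim/big_rec2: _ => // k y z _ <-; rewrite lpD. Qed.

Lemma lpeZ (I : choiceType) (c : R[i]) (x : I -> R[i]) :
  lpe (fun i => c * x i)%R = (cmod c `^ p)%:E * lpe x.
Proof.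
rewrite /lpe -esumZl ?powR_ge0//; last by move=> i; rewrite lee_fin powR_ge0.
apply: eq_esum => i _.
by rewrite ComplexField.Normc.normcM powRM ?cmod_ge0// EFinM.
Qed.

Lemma lpnormZ (I : choiceType) (c : R[i]) (x : lp hp I) :
  (lpnorm (c *: x) = cmod c * lpnorm x)%R.
Proof.
have /eqP : lpe (c *: x)%R = (cmod c `^ p)%:E * lpe x := lpeZ c x.
rewrite !lpe_lp -EFinM -powRM ?cmod_ge0 ?lpnorm_ge0// eqe => /eqP H.
rewrite -(powRK (lpnorm_ge0 _)) H powRK//.
by rewrite mulr_ge0 ?cmod_ge0 ?lpnorm_ge0.
Qed.

Lemma lpe_coord (I : choiceType) (x : I -> R[i]) i :
  (cmod (x i) `^ p)%:E <= lpe x.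
Proof.
apply: ereal_sup_ubound; exists [set i]; first by split.
by rewrite fsbig_set1.
Qed.

Lemma lpnorm_coord (I : choiceType) (x : lp hp I) i :
  (cmod (x i) <= lpnorm x)%R.
Proof.
have := lpe_coord x i.
by rewrite lpe_lp lee_fin ler_powR2 ?cmod_ge0 ?lpnorm_ge0.
Qed.

Lemma lpnorm_eq0 (I : choiceType) (x : lp hp I) : lpnorm x = 0%R -> x = 0%R.
Proof.
move=> x0; apply: lpE => i; apply: ComplexField.Normc.eq0_normc.
by apply/eqP; rewrite eq_le cmod_ge0 andbT -x0 lpnorm_coord.
Qed.

Lemma powR_conv (t x y : R) : (0 <= t)%R -> (t <= 1)%R ->
  (0 <= x)%R -> (0 <= y)%R ->
  ((t * x + (1 - t) * y) `^ p <= t * x `^ p + (1 - t) * y `^ p)%R.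
Proof.
move=> t0 t1 x0 y0.
have := @convex_powR R p hp (Itv01 t0 t1) x y.
rewrite !inE/= !in_itv/= !andbT => /(_ x0 y0).
by rewrite !convRE/= /unstable.onem.
Qed.

(** Convexity of the [p]-th power, with weights [a / (a + b)] and [b / (a + b)], at the points
    [x / a] and [y / b], whose convex combination is [(x + y) / (a + b)]. *)
Lemma powRD_conv (a b x y : R) : (0 < a)%R -> (0 < b)%R ->
  (0 <= x)%R -> (0 <= y)%R ->
  ((x + y) `^ p <= (a + b) `^ p *
     (a / (a + b) * (a^-1 `^ p * x `^ p) +
      b / (a + b) * (b^-1 `^ p * y `^ p)))%R.
Proof.
move=> a0 b0 x0 y0.
have ab : (0 < a + b)%R by rewrite addr_gt0.
have t0 : (0 <= a / (a + b))%R by rewrite divr_ge0 ?(ltW a0) ?(ltW ab).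
have t1 : (a / (a + b) <= 1)%R by rewrite ler_pdivrMr// mul1r lerDl (ltW b0).
have hb : (1 - a / (a + b) = b / (a + b))%R by field; rewrite gt_eqF.
have ax : (0 <= a^-1 * x)%R by rewrite mulr_ge0// invr_ge0 ltW.
have bY : (0 <= b^-1 * y)%R by rewrite mulr_ge0// invr_ge0 ltW.
have := powR_conv t0 t1 ax bY; rewrite hb.
rewrite -!powRM ?invr_ge0 ?(ltW a0) ?(ltW b0)//.
move=> /(ler_wpM2l (powR_ge0 (a + b)%R p)); apply: le_trans.
rewrite -powRM ?(ltW ab)//; last first.
  by rewrite addr_ge0// mulr_ge0// divr_ge0 ?(ltW b0) ?(ltW ab).
rewrite le_eqVlt; apply/orP; left; apply/eqP; congr powR.
by field; rewrite !gt_eqF.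
Qed.

(** This is what remains of the bracket in [powRD_conv] once it is summed over the coordinates of
    vectors of norms [a] and [b]. *)
Lemma powR_conv_norm (a b : R) : (0 < a)%R -> (0 < b)%R ->
  (a / (a + b) * a^-1 `^ p * a `^ p + b / (a + b) * b^-1 `^ p * b `^ p = 1)%R.
Proof.
move=> a0 b0; have ab : (0 < a + b)%R by rewrite addr_gt0.
have VM (c : R) : (0 < c -> c^-1 `^ p * c `^ p = 1)%R.
  move=> c0; rewrite -powRM ?invr_ge0 ?(ltW c0)//.
  by rewrite mulVf ?(gt_eqF c0)// powR1.
by rewrite -!mulrA !VM// !mulr1 -mulrDl divff// (gt_eqF ab).
Qed.

(* Minkowski: [x + y] is [a + b] times a convex combination of the normalized
   [x / a] and [y / b], where [a] and [b] are the norms. *)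
Lemma lpnormD (I : choiceType) (x y : lp hp I) :
  (lpnorm (x + y) <= lpnorm x + lpnorm y)%R.
Proof.
have [x0|xn0] := eqVneq (lpnorm x) 0%R.
  by rewrite x0 (lpnorm_eq0 x0) !add0r.
have [y0|yn0] := eqVneq (lpnorm y) 0%R.
  by rewrite y0 (lpnorm_eq0 y0) !addr0.
set a := lpnorm x in xn0 *; set b := lpnorm y in yn0 *.
have a0 : (0 < a)%R by rewrite lt_neqAle eq_sym xn0 lpnorm_ge0.
have b0 : (0 < b)%R by rewrite lt_neqAle eq_sym yn0 lpnorm_ge0.
have ab : (0 < a + b)%R by rewrite addr_gt0.
rewrite -ler_powR2 ?lpnorm_ge0 ?(ltW ab)// -lee_fin -lpe_lp.
apply: (@le_trans _ _ (\esum_(i in [set: I]) (((a + b) `^ p)%:E *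
  (((a / (a + b)) * a^-1 `^ p)%:E * (cmod (x i) `^ p)%:E
   + ((b / (a + b)) * b^-1 `^ p)%:E * (cmod (y i) `^ p)%:E)))).
  apply: le_esum => i _; rewrite -!EFinM lee_fin.
  apply: (@le_trans _ _ ((cmod (x i) + cmod (y i)) `^ p)%R).
    by rewrite ler_powR2 ?addr_ge0 ?cmod_ge0// cmodD.
  by apply: le_trans (powRD_conv a0 b0 _ _) _; rewrite ?cmod_ge0// !mulrA.
have c0 (c z : R) :
    (0 < c)%R -> 0 <= (c / (a + b) * c^-1 `^ p)%:E * (z `^ p)%:E.
  move=> cp; rewrite -EFinM lee_fin !mulr_ge0 ?powR_ge0 ?invr_ge0 ?(ltW cp)//.
  exact: ltW ab.
have d0 (c : R) : (0 < c -> 0 <= (c / (a + b) * c^-1 `^ p))%R.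
  by move=> cp; rewrite !mulr_ge0 ?powR_ge0 ?invr_ge0 ?(ltW cp) ?(ltW ab).
rewrite esumZl ?powR_ge0//; last by move=> i; rewrite adde_ge0// c0.
rewrite esumD; [|by move=> i _; exact: c0..].
rewrite !esumZl ?d0//; do ?by move=> i; rewrite lee_fin powR_ge0.
rewrite -/(lpe x) -/(lpe y) !lpe_lp -!EFinM lee_fin -/a -/b.
by rewrite powR_conv_norm// mulr1.
Qed.

End Energy.

Lemma ex_linear (K : pzRingType) (V W : lmodType K) (f : V -> W) :
  linear f -> exists F : {linear V -> W}, F =1 f.
Proof.
move=> lf.
pose F := HB.pack_for {linear V -> W} f (GRing.isLinear.Build K V W *:%R f lf).
by exists F.
Qed.

(** * Operator norms *)

Section Opnorm.
Context {R : realType} {V W : Type} (N : V -> R) (M : W -> R) (T : V -> W).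
Hypothesis N0 : forall x, 0 <= N x.

Lemma opnorm_ge0 : 0 <= opnorm N M T.
Proof.
rewrite /opnorm; set E := [set _ | _].
have [->|/set0P[C EC]] := eqVneq E set0; first by rewrite inf0.
by apply: lb_le_inf; [exists C|move=> D []].
Qed.

Lemma opnorm_le (C : R) :
  0 <= C -> (forall x, M (T x) <= C * N x) -> opnorm N M T <= C.
Proof. by move=> C0 CT; apply: ge_inf => //; exists 0 => D []. Qed.

Lemma op_boundedP (C : R) : (forall x, M (T x) <= C * N x) -> op_bounded N M T.
Proof. by exists C. Qed.

(** Where [N x = 0], any bounding constant gives [M (T x) <= 0]; elsewhere one divides by [N x] and
    passes to the infimum. *)
Lemma opnormP : op_bounded N M T -> forall x, M (T x) <= opnorm N M T * N x.
Proof.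
move=> [C CT] x; have [Nx0|Nxn0] := eqVneq (N x) 0.
  by rewrite Nx0 mulr0; have := CT x; rewrite Nx0 mulr0.
have Nx : 0 < N x by rewrite lt_neqAle eq_sym Nxn0 N0.
rewrite -ler_pdivrMr//; apply: lb_le_inf.
  (* A bounding constant [C] may be negative, whereas [opnorm] takes the infimum over nonnegative
     ones. *)
  exists (Num.max C 0); split; first by rewrite le_max lexx orbT.
  move=> y; apply: le_trans (CT y) _.
  by rewrite ler_wpM2r// le_max lexx.
by move=> D [_ DT]; rewrite ler_pdivrMr.
Qed.

End Opnorm.

Lemma cmodN (R : realType) (z : R[i]) : cmod (- z) = cmod z.
Proof. by case: z => a b; rewrite /= !sqrrN. Qed.

(** * Density of finitely supported families *)

Section Density.
Context {R : realType} {p : R} (hp : 1 <= p).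
Local Open Scope ereal_scope.

Lemma lpnormN (I : choiceType) (x : lp hp I) : lpnorm (- x)%R = lpnorm x.
Proof. by rewrite -scaleN1r lpnormZ cmodN ComplexField.Normc.normc1 mul1r. Qed.

Lemma lpe_support1 (I : choiceType) (k : I) (x : I -> R[i]) :
  (forall i, i != k -> x i = 0)%R -> lpe (p := p) x = (cmod (x k) `^ p)%:E.
Proof.
move=> xk; rewrite -(@esum_set1 R I k (fun i => (cmod (x i) `^ p)%:E)).
  rewrite [RHS]esum_mkcond; apply: eq_esum => i _.
  case: ifPn => //; rewrite notin_setE => /eqP ik.
  by rewrite xk// ComplexField.Normc.normc0 powR0// exponent_neq0.
by rewrite lee_fin powR_ge0.
Qed.

Lemma delta_lp (I : choiceType) (k : I) :
  (fun i => (i == k)%:R : R[i]) \in lp_pred hp (I := I).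
Proof.
rewrite inE lpnorme_lty// -/(lpe _) (lpe_support1 (k := k)) ?ltry// => i.
by move=> /negPf ->.
Qed.

Definition lpdelta (I : choiceType) (k : I) : lp hp I := Lp (delta_lp k).

Lemma lpdeltaE (I : choiceType) (k i : I) : lpdelta k i = (i == k)%:R%R.
Proof. by []. Qed.

Lemma lpnorm_delta (I : choiceType) (k : I) : lpnorm (lpdelta k) = 1%R.
Proof.
rewrite /lpnorm lpnormeE (lpe_support1 (k := k)) => [|i /negPf ik]; last first.
  by rewrite /= ik.
by rewrite /= eqxx ComplexField.Normc.normc1 !powR1.
Qed.

Lemma trunc_coord (I : choiceType) (u : lp hp I) (s : seq I) i : uniq s ->
  (u - \sum_(k <- s) u k *: lpdelta k)%R i = (if i \in s then 0 else u i)%R.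
Proof.
move=> us; rewrite lpD lpN lp_sum; case: ifPn => si.
  apply/eqP; rewrite subr_eq0; apply/eqP; rewrite (bigD1_seq i)//.
  rewrite lpZ lpdeltaE eqxx mulr1 big1 => [|k ki]; first by rewrite /= addr0.
  by rewrite lpZ lpdeltaE eq_sym (negPf ki) mulr0.
rewrite big_seq big1 ?subr0// => k ks.
rewrite lpZ lpdeltaE (_ : (i == k) = false) ?mulr0//.
by apply: contraNF si => /eqP ->.
Qed.

(** Some finite set [A] carries [lpe u] up to an error below [e] to the power [p]; subtracting the
    truncation of [u] to [A] leaves exactly the rest of the sum. *)
Lemma lp_approx (I : choiceType) (u : lp hp I) (e : R) : (0 < e)%R ->
  exists s : seq I, (lpnorm (u - \sum_(k <- s) u k *: lpdelta k) <= e)%R.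
Proof.
move=> e0; have ep0 : (0 < e `^ p)%R by exact: powR_gt0.
have ufin : lpe (p := p) u \is a fin_num by rewrite lpe_lp.
have [_ [A [fA _] <-] uA] := ub_ereal_sup_adherent ep0 ufin.
set s : seq I := enum_fset (fset_set A).
have us : uniq s by exact: fset_uniq.
have sA i : (i \in s) = (i \in A) by rewrite -in_fset_set.
exists s; rewrite -(ler_powR2 hp) ?lpnorm_ge0 ?(ltW e0)//.
rewrite -lee_fin -lpe_lp.
have {}uA : lpe (p := p) u - (e `^ p)%:E < \sum_(i \in A) (cmod (u i) `^ p)%:E
  := uA.
have u0 i : 0 <= (cmod (u i) `^ p)%:E by rewrite lee_fin powR_ge0.
have H : lpe (p := p) u = \sum_(i \in A) (cmod (u i) `^ p)%:E +
   lpe (p := p) (u - \sum_(k <- s) u k *: lpdelta k)%R.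
  rewrite {1}/lpe.
  rewrite (@esumID R I A _ _ (fun i _ => u0 i)) setTI.
  rewrite (esum_fset fA)//; congr (_ + _).
  rewrite esum_mkcond; apply: eq_esum => i _; rewrite trunc_coord// sA setTI.
  rewrite in_setC; case: (i \in A) => //.
  have n0 : (cmod (0 : R[i]) `^ p)%:E = 0.
    by rewrite ComplexField.Normc.normc0 powR0// exponent_neq0.
  exact: (esym n0).
move: uA; rewrite H.
rewrite lpe_lp fsbig_finite//= sumEFin lte_fin lee_fin.
by rewrite ltrBlDr ltrD2l => /ltW.
Qed.

(** Both maps agree on a truncation [w] of [u], so [D u - E u = D (u - w) - E (u - w)], which
    boundedness makes arbitrarily small. *)
Lemma bounded_linear_eq (I J : choiceType) (D E : {linear lp hp I -> lp hp J}) :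
  op_bounded lpnorm lpnorm D -> op_bounded lpnorm lpnorm E ->
  (forall k, D (lpdelta k) = E (lpdelta k)) -> D =1 E.
Proof.
move=> bD bE DE u; apply/eqP; rewrite -subr_eq0; apply/eqP/lpnorm_eq0.
apply/eqP; rewrite eq_le lpnorm_ge0 andbT.
(* The summand 1 keeps [C] positive, so that the truncation error can be taken at most [e / C]. *)
set C := (opnorm (@lpnorm R p hp I) (@lpnorm R p hp J) D
          + opnorm (@lpnorm R p hp I) (@lpnorm R p hp J) E + 1)%R.
have N0 := @lpnorm_ge0 R p hp I.
have C0 : (0 < C)%R by rewrite ltr_wpDl// addr_ge0 ?opnorm_ge0.
apply/ler_addgt0Pl => e e0; rewrite addr0.
have [s us] := lp_approx u (divr_gt0 e0 C0).
set w := (\sum_(k <- s) _)%R in us.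
have Dw : D w = E w.
  by rewrite !linear_sum; apply: eq_bigr => k _; rewrite !linearZ/= DE.
have -> : (D u - E u = D (u - w) - E (u - w))%R.
  by rewrite (linearB D) (linearB E) Dw opprB addrA subrK.
apply: le_trans (lpnormD _ _) _.
rewrite lpnormN; apply: (@le_trans _ _ (C * lpnorm (u - w))%R).
  apply: le_trans (lerD (opnormP N0 bD _) (opnormP N0 bE _)) _.
  by rewrite -mulrDl ler_wpM2r// lerDl.
by rewrite mulrC -ler_pdivlMr.
Qed.

End Density.

(** * Iterated sums over tuples and over lines *)

Section Fubini.
Context {R : realType} {p : R} (hp : 1 <= p).
Local Open Scope ereal_scope.

(** The inner roots cancel against the outer powers, which leaves a sum over pairs of head and tail;
    both sides may be infinite. *)
Lemma lpnorme_cons (m : nat) (u : m.+1.-tuple nat -> R[i]) :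
  lpnorme p u = lpsum p (fun j : nat =>
    lpnorme p (fun t : m.-tuple nat => u [tuple of j :: t])).
Proof.
rewrite /lpsum lpnormeE; congr (_ `^ _).
under [RHS]eq_esum do rewrite lpnorme_poweR//.
rewrite -(@esum_pair R _ _ (fun (j : nat) (t : m.-tuple nat) =>
  (cmod (u [tuple of j :: t]) `^ p)%:E)).
  apply: esum_bij.
  exists (fun t : m.+1.-tuple nat => (thead t, [tuple of behead t])).
    move=> [j t]; congr pair.
    exact/val_inj.
  by move=> t; apply/esym/val_inj; rewrite {1}(tuple_eta t).
by move=> j t; rewrite lee_fin powR_ge0.
Qed.

Lemma lpnorme_tensor (x y : lp hp nat) :
  lpnorme p (fun ij : nat * nat => x ij.1 * y ij.2)%R =
  (lpnorm x * lpnorm y)%:E.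
Proof.
rewrite lpnormeE /lpe (@esum_pair R _ _ (fun i j => (cmod (x i * y j) `^ p)%:E)).
  under eq_esum do rewrite -/(lpe (fun j => x _ * y j)%R) lpeZ// lpe_lp muleC.
  rewrite esumZl ?powR_ge0//; last by move=> i; rewrite lee_fin powR_ge0.
  rewrite -/(lpe _) lpe_lp -EFinM -powRM ?lpnorm_ge0// poweR_EFin.
  by rewrite powRK ?mulr_ge0 ?lpnorm_ge0// mulrC.
by move=> i j; rewrite lee_fin powR_ge0.
Qed.

Variable n : nat.

Lemma tnth_put (k : 'I_n) (t : n.-tuple nat) j r :
  tnth (put k t j) r = if r == k then j else tnth t r.
Proof. by rewrite tnth_mktuple. Qed.

Lemma put_put (k : 'I_n) (t : n.-tuple nat) i j :
  put k (put k t i) j = put k t j.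
Proof. by apply: eq_from_tnth => r; rewrite !tnth_put; case: eqP. Qed.

Lemma put_id (k : 'I_n) (t : n.-tuple nat) : put k t (tnth t k) = t.
Proof. by apply: eq_from_tnth => r; rewrite !tnth_put; case: eqP => // ->. Qed.

(* The lines in direction k are indexed by their points with k-th entry 0. *)
Lemma esum_lines (k : 'I_n) (a : n.-tuple nat -> \bar R) :
  (forall t, 0 <= a t) ->
  \esum_(t in [set: n.-tuple nat]) a t =
  \esum_(t in [set t | tnth t k = 0%N]) \esum_(j in [set: nat]) a (put k t j).
Proof.
move=> a0; rewrite esum_esum//.
apply: (@reindex_esum _ _ _ _ _
  (fun z : n.-tuple nat * nat => put k z.1 z.2)).
split=> //.
  move=> [t i] [s j] /set_mem[/= t0 _] /set_mem[/= s0 _] E; congr pair.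
    by rewrite -(put_id k t) -(put_id k s) t0 s0 -(put_put k t i) E put_put.
  by have := congr1 (fun t => tnth t k) E; rewrite !tnth_put eqxx.
move=> t _; exists (put k t 0%N, tnth t k) => /=.
  by split=> //=; rewrite tnth_put eqxx.
by rewrite put_put put_id.
Qed.

End Fubini.

(** * Slicewise action and tensor products of operators *)

Section Slice.
Context {R : realType} {p : R} (hp : 1 <= p) (n : nat).

Lemma fiber_put (k : 'I_n) (t : n.-tuple nat) j (u : lp hp (n.-tuple nat)) :
  fiber k (put k t j) u = fiber k t u.
Proof. by apply: lpE => i /=; rewrite put_put. Qed.

Lemma fiberP (k : 'I_n) (t : n.-tuple nat) (c : R[i])
    (u v : lp hp (n.-tuple nat)) :
  fiber k t (c *: u + v) = c *: fiber k t u + fiber k t v.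
Proof. exact: lpE. Qed.

(** The bound for [T] holds on each line in direction [k], and [esum_lines] adds these bounds up. *)
Lemma slice_lpe (k : 'I_n) (T : lp hp nat -> lp hp nat) (C : R)
    (u : lp hp (n.-tuple nat)) :
  0 <= C -> (forall x, lpnorm (T x) <= C * lpnorm x) ->
  (lpe (p := p) (fun t : n.-tuple nat => T (fiber k t u) (tnth t k)) <=
   (C `^ p)%:E * lpe (p := p) u)%E.
Proof.
move=> C0 CT.
have pos (z : R[i]) : (0 <= (cmod z `^ p)%:E)%E by rewrite lee_fin powR_ge0.
rewrite /lpe (esum_lines k)//.
rewrite (@esum_lines R n k (fun t => (cmod (u t) `^ p)%:E))//.
(* [esumZl] sums over a whole type, so the sum over lines is extended by 0 to all tuples. *)
rewrite [X in (_ <= _ * X)%E]esum_mkcond -esumZl ?powR_ge0//; last first.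
  by move=> t; case: ifP => // _; exact: esum_ge0.
rewrite esum_mkcond; apply: le_esum => t _.
case: ifP => _; last by rewrite mule0.
(* All points of a line have the same fiber, so the inner sum is [lpe] of [T (fiber k t u)]. *)
under eq_esum do rewrite fiber_put tnth_put eqxx.
by rewrite -/(lpe (T (fiber k t u))) -/(lpe (fiber k t u)) -lpnorm_leM.
Qed.

Lemma ex_slice (k : 'I_n) (T : {linear lp hp nat -> lp hp nat}) :
  op_bounded lpnorm lpnorm T ->
  exists A : {linear lp hp (n.-tuple nat) -> lp hp (n.-tuple nat)},
    [/\ slicewise k T A, op_bounded lpnorm lpnorm A
      & opnorm lpnorm lpnorm A <= opnorm lpnorm lpnorm T].
Proof.
move=> bT; set C := opnorm lpnorm lpnorm T.
have N0 := @lpnorm_ge0 R p hp nat.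
have C0 : 0 <= C by exact: opnorm_ge0.
have CT := opnormP N0 bT.
have mem u : (fun t : n.-tuple nat => T (fiber k t u) (tnth t k))
    \in lp_pred hp (I := n.-tuple nat).
  rewrite inE lpnorme_lty//; apply: le_lt_trans (slice_lpe k u C0 CT) _.
  by rewrite lpe_lp -EFinM ltry.
have [A AE] : exists A : {linear lp hp (n.-tuple nat) -> lp hp (n.-tuple nat)},
    A =1 (fun u => Lp (mem u)).
  by apply: ex_linear => c u v; apply: lpE => t /=; rewrite fiberP linearP.
have bA u : lpnorm (A u) <= C * lpnorm u.
  by rewrite AE lpnorm_leM// slice_lpe.
exists A; split=> [u t||]; first by rewrite AE.
  by exists C.
exact: opnorm_le.
Qed.

Lemma fiber_tens (k : 'I_n) (x : 'I_n -> lp hp nat) t :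
  fiber k t (tens x) = (\prod_(r | r != k) x r (tnth t r)) *: x k.
Proof.
apply: lpE => j; rewrite lpZ /= (bigD1 k)//= tnth_put eqxx mulrC; congr (_ * _).
by apply: eq_bigr => r /negPf rk; rewrite tnth_put rk.
Qed.

(** The fiber of an elementary tensor is a multiple of its [k]-th factor, so linearity of [T] pulls
    the other factors out. *)
Lemma slice_tens (k : 'I_n) (T : {linear lp hp nat -> lp hp nat})
    (A : lp hp (n.-tuple nat) -> lp hp (n.-tuple nat)) x :
  slicewise k T A ->
  A (tens x) = tens (fun r => if r == k then T (x r) else x r).
Proof.
move=> AT; apply: lpE => t.
rewrite AT fiber_tens linearZ lpZ /= [RHS](bigD1 k)//=.
rewrite eqxx mulrC; congr (_ * _).
by apply: eq_bigr => r /negPf ->.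
Qed.

(** Through this, density shows that a bounded linear operator is determined by its values on
    elementary tensors. *)
Lemma delta_tens (t : n.-tuple nat) :
  lpdelta hp t = tens (fun r => lpdelta hp (tnth t r)).
Proof.
apply: lpE => s; rewrite lpdeltaE /=; case: eqP => [->|st].
  by rewrite big1// => r _; rewrite eqxx.
have [r rst] : exists r, tnth s r != tnth t r.
  apply/existsP; apply: contra_notT st => /existsPn H.
  by apply: eq_from_tnth => r; apply/eqP/negPn/H.
by rewrite (bigD1 r)//= (negPf rst) mul0r.
Qed.

Lemma tensor_op_uniq (T : 'I_n -> lp hp nat -> lp hp nat)
    (S S' : {linear lp hp (n.-tuple nat) -> lp hp (n.-tuple nat)}) :
  tensor_op T S -> tensor_op T S' -> S' =1 S.
Proof.
move=> [bS ST] [bS' ST']; apply: bounded_linear_eq => // t.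
by rewrite delta_tens ST ST'.
Qed.

(** Induction on the list of directions; as it has no repetition, [T k] hits the [k]-th factor at
    most once. The tensor product is the case of all directions. *)
Lemma foldr_slice (T : 'I_n -> {linear lp hp nat -> lp hp nat})
    (A : 'I_n -> {linear lp hp (n.-tuple nat) -> lp hp (n.-tuple nat)})
    (s : seq 'I_n) :
  uniq s ->
  (forall k, slicewise k (T k) (A k)) ->
  (forall k, op_bounded lpnorm lpnorm (A k)) ->
  [/\ linear (fun u => foldr (fun k => A k) u s),
      forall x, foldr (fun k => A k) (tens x) s =
        tens (fun r => if r \in s then T r (x r) else x r)
    & forall u, lpnorm (foldr (fun k => A k) u s) <=
        \prod_(k <- s) opnorm lpnorm lpnorm (A k) * lpnorm u].
Proof.
move=> + AT bA; elim: s => [_|k s IH /= /andP[ks us]]/=.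
  by split=> // u; rewrite big_nil mul1r.
have [lin te bo] := IH us; split=> [c u v|x|u].
- by rewrite lin linearP.
- rewrite te (slice_tens _ (AT k)); congr tens; apply/funext => r.
  by rewrite in_cons; case: eqP => //= ->; rewrite (negPf ks).
- apply: le_trans (opnormP (@lpnorm_ge0 R p hp _) (bA k) _) _.
  by rewrite big_cons -mulrA ler_wpM2l// opnorm_ge0//; exact: lpnorm_ge0.
Qed.

(** The norm estimate is pointwise so that it passes to algebraic tensors and to alternating
    functions. *)
Lemma ex_tensor_op (T : 'I_n -> {linear lp hp nat -> lp hp nat}) :
  (forall r, op_bounded lpnorm lpnorm (T r)) ->
  exists S : {linear lp hp (n.-tuple nat) -> lp hp (n.-tuple nat)},
    [/\ tensor_op T S,
        exists A : 'I_n ->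
            {linear lp hp (n.-tuple nat) -> lp hp (n.-tuple nat)},
          (forall k,
             [/\ slicewise k (T k) (A k), op_bounded lpnorm lpnorm (A k)
               & opnorm lpnorm lpnorm (A k) <= opnorm lpnorm lpnorm (T k)])
          /\ (forall u, S u = foldr (fun k => A k) u (enum 'I_n))
      & forall u, lpnorm (S u) <=
          \prod_r opnorm lpnorm lpnorm (T r) * lpnorm u].
Proof.
move=> bT; have [A AP] := choice (fun k => ex_slice k (bT k)).
have [lin te bo] := foldr_slice (enum_uniq 'I_n)
  (fun k => let: And3 a _ _ := AP k in a)
  (fun k => let: And3 _ a _ := AP k in a).
have [S SE] := ex_linear lin.
have bS u : lpnorm (S u) <= \prod_r opnorm lpnorm lpnorm (T r) * lpnorm u.
  rewrite SE; apply: le_trans (bo u) _.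
  rewrite ler_wpM2r ?lpnorm_ge0// big_enum/=; apply: ler_prod => k _.
  by rewrite opnorm_ge0 ?(let: And3 _ _ a := AP k in a)//; exact: lpnorm_ge0.
exists S; split=> //; last by exists A.
split; first by exists (\prod_r opnorm lpnorm lpnorm (T r)).
by move=> x; rewrite SE te; congr tens; apply/funext => r; rewrite mem_enum.
Qed.

End Slice.

(** * The coordinate norm as a uniform reasonable crossnorm *)

Section TensorNorm.
Context {R : realType} {p : R} (hp : 1 <= p).

(** Induction on the number of factors: with the first entry fixed, the slice is a scalar times the
    tensor of the remaining factors. Without factors there is one coordinate, the empty product
    1. *)
Lemma lpe_tens (n : nat) (x : 'I_n -> lp hp nat) :
  lpe (p := p) (tens x) = ((\prod_r lpnorm (x r)) `^ p)%:E.
Proof.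
elim: n x => [|n IH] x.
  rewrite (lpe_support1 hp (k := [tuple])) => [|t /eqP[]]; last exact: tuple0.
  by rewrite /= !big_ord0 ComplexField.Normc.normc1.
rewrite -(lpnorme_poweR hp) (lpnorme_cons hp) poweRVK//; last first.
  by apply: esum_ge0 => j _; exact: poweR_ge0.
under eq_esum do rewrite lpnorme_poweR//.
pose y r := x (lift ord0 r).
have E j : (lpe (p := p) (fun t : n.-tuple nat => tens x [tuple of j :: t]) =
    ((\prod_r lpnorm (y r)) `^ p)%:E * (cmod (x ord0 j) `^ p)%:E)%E.
  rewrite muleC -IH -lpeZ//; congr lpe; apply/funext => t /=.
  rewrite big_ord_recl; congr (_ * _); apply: eq_bigr => r _.
  by rewrite tnthS.
under eq_esum do rewrite E.
rewrite esumZl ?powR_ge0//; last by move=> i; rewrite lee_fin powR_ge0.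
rewrite -/(lpe _) lpe_lp -EFinM -powRM ?lpnorm_ge0//; last first.
  by apply: prodr_ge0 => r _; exact: lpnorm_ge0.
by rewrite big_ord_recl mulrC.
Qed.

Lemma lpnorm_tens (n : nat) (x : 'I_n -> lp hp nat) :
  lpnorm (tens x) = \prod_r lpnorm (x r).
Proof.
have P0 : 0 <= \prod_r lpnorm (x r).
  by apply: prodr_ge0 => r _; exact: lpnorm_ge0.
have /eqP := lpe_tens x; rewrite lpe_lp eqe => /eqP H.
by rewrite -(powRK hp (lpnorm_ge0 _)) H powRK.
Qed.

Variable n : nat.
Local Notation coord_norm := (@coord_norm R p hp n).

Lemma coord_norm_ge0 u : 0 <= coord_norm u.
Proof. exact: lpnorm_ge0. Qed.

Lemma coord_is_norm : is_norm coord_norm.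
Proof.
split=> [u v|c u|u u0]; first exact: lpnormD.
  exact: lpnormZ.
by apply/val_inj/lpnorm_eq0.
Qed.

(** The operator on all of [lp hp (n.-tuple nat)] maps elementary tensors to elementary tensors,
    hence restricts to their span with the same bound. *)
Lemma coord_uniform : uniform_norm coord_norm.
Proof.
move=> T bT; have [S0 [[_ ST] _ bS]] := ex_tensor_op bT.
have mem (u : atens hp n) : S0 u \in @atens_pred R p hp n.
  have /asboolP[s ->] := atvalP u; rewrite linear_sum; apply: rpred_sum => cx _.
  by rewrite linearZ/= ST rpredZ//; exact: (atvalP (atens_elt _)).
have [S SE] : exists S : {linear atens hp n -> atens hp n},
    S =1 (fun u => ATens (mem u)).
  by apply: ex_linear => c u v; apply/val_inj; rewrite /= linearP.
have bSu u : coord_norm (S u) <=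
    \prod_r opnorm lpnorm lpnorm (T r) * coord_norm u by rewrite SE; exact: bS.
exists S; split=> [x||].
- by apply/val_inj; rewrite SE /= ST.
- by exists (\prod_r opnorm lpnorm lpnorm (T r)).
- apply: opnorm_le => //; apply: prodr_ge0 => r _; exact: opnorm_ge0.
Qed.

(* The norms of the functionals are recovered one at a time, the remaining
   vectors being kept free. *)
Lemma prod_opnorm_le (I : eqType) (V : Type) (v0 : V) (N : V -> R)
    (phi : I -> V -> R[i]) (C : R) (s : seq I) :
  (forall v, 0 <= N v) -> uniq s -> 0 <= C ->
  (forall x : I -> V, \prod_(r <- s) cmod (phi r (x r))
     <= C * \prod_(r <- s) N (x r)) ->
  \prod_(r <- s) opnorm N cmod (phi r) <= C.
Proof.
move=> N0; elim: s C => [|k s IH] C /= us C0 H.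
  by have := H (fun=> v0); rewrite !big_nil mulr1.
case/andP: us => ks us; rewrite big_cons.
set P := \prod_(r <- s) _.
have P0 : 0 <= P by apply: prodr_ge0 => r _; exact: opnorm_ge0.
have [PE0|Pn0] := eqVneq P 0; first by rewrite PE0 mulr0.
have {P0 Pn0}Pp : 0 < P by rewrite lt_neqAle eq_sym Pn0.
rewrite -ler_pdivlMr//; apply: opnorm_le => [|y].
  by rewrite divr_ge0// ltW.
have [->|yn0] := eqVneq (cmod (phi k y)) 0.
  by rewrite mulr_ge0// divr_ge0// ltW.
have yp : 0 < cmod (phi k y) by rewrite lt_neqAle eq_sym yn0 cmod_ge0.
suff : P <= C * N y / cmod (phi k y).
  by rewrite ler_pdivlMr// mulrAC ler_pdivlMr// mulrC.
apply: IH => // [|x]; first by rewrite divr_ge0 ?(ltW yp)// mulr_ge0.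
pose z r := if r == k then y else x r.
have zx r : r \in s -> z r = x r.
  by rewrite /z; case: eqP => // ->; rewrite (negPf ks).
have := H z; rewrite !big_cons {1 3}/z eqxx.
rewrite (eq_big_seq (fun r => cmod (phi r (x r)))) => [|r /zx ->//].
rewrite (eq_big_seq (fun r => N (x r))) => [|r /zx ->//].
by rewrite mulrA => h; rewrite mulrAC ler_pdivlMr// mulrC.
Qed.

(** The upper bound comes from [ex_tensor_op], the lower one from testing [Phi] on elementary
    tensors, whose norm is the product of the norms. *)
Lemma coord_dual (phi : 'I_n -> {linear lp hp nat -> R[i]}) :
  (forall r, op_bounded lpnorm cmod (phi r)) ->
  exists Phi : {linear atens hp n -> R[i]},
    [/\ forall x, Phi (atens_elt x) = \prod_r phi r (x r),
        op_bounded coord_norm cmod Phi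
      & opnorm coord_norm cmod Phi = \prod_r opnorm lpnorm cmod (phi r)].
Proof.
move=> bphi; have N0 := @lpnorm_ge0 R p hp nat.
(* Each functional is turned into an operator of rank one. *)
have /choice[T TE] (r : 'I_n) : exists T : {linear lp hp nat -> lp hp nat},
    T =1 fun x => phi r x *: lpdelta hp 0%N.
  by apply: ex_linear => c u v; rewrite linearP scalerDl scalerA.
have bT r x : lpnorm (T r x) <= opnorm lpnorm cmod (phi r) * lpnorm x.
  by rewrite TE lpnormZ lpnorm_delta mulr1 opnormP.
have [S [[_ ST] _ bS]] := ex_tensor_op (fun r => op_boundedP (bT r)).
(* Every [T r] takes values in the line of [lpdelta hp 0], so the coordinate at the zero tuple
   carries the whole product. *)
have [Phi PhiE] : exists Phi : {linear atens hp n -> R[i]},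
    Phi =1 (fun u => S u [tuple 0%N | _ < n]).
  by apply: ex_linear => c u v; rewrite /= linearP.
have Phit x : Phi (atens_elt x) = \prod_r phi r (x r).
  rewrite PhiE /= ST; apply: eq_bigr => r _.
  by rewrite TE tnth_mktuple lpZ lpdeltaE eqxx mulr1.
have D0 : 0 <= \prod_r opnorm lpnorm cmod (phi r).
  by apply: prodr_ge0 => r _; exact: opnorm_ge0.
have bPhi u : cmod (Phi u) <=
    \prod_r opnorm lpnorm cmod (phi r) * coord_norm u.
  rewrite PhiE; apply: le_trans (lpnorm_coord _ _) _; apply: le_trans (bS _) _.
  rewrite ler_wpM2r ?lpnorm_ge0//; apply: ler_prod => r _.
  by rewrite opnorm_ge0//= opnorm_le// opnorm_ge0.
exists Phi; split=> //; first by exists (\prod_r opnorm lpnorm cmod (phi r)).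
apply/eqP; rewrite eq_le opnorm_le//=.
have enumE (F : 'I_n -> R) : \prod_(r <- enum 'I_n) F r = \prod_r F r.
  by rewrite big_enum.
rewrite -enumE.
apply: (prod_opnorm_le 0) => //; first exact: enum_uniq.
  exact: opnorm_ge0.
move=> x; rewrite !enumE -lpnorm_tens.
rewrite -(big_morph _ (@ComplexField.Normc.normcM R)
  (@ComplexField.Normc.normc1 R)).
rewrite -Phit; apply: (opnormP coord_norm_ge0).
by exists (\prod_r opnorm lpnorm cmod (phi r)).
Qed.

Lemma coord_reasonable : reasonable_crossnorm coord_norm.
Proof.
split; [exact: coord_is_norm|exact: lpnorm_tens|exact: coord_dual].
Qed.

End TensorNorm.

(** * The alternating extension and its norm *)

Section AlternatingExtension.
Context {R : realType} {n : nat}.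
Implicit Types (w : nsubset n -> R[i]) (t : n.-tuple nat) (s q : 'S_n).

Definition tuple_act s t : n.-tuple nat := [tuple tnth t (s r) | r < n].

Definition elems (I : nsubset n) : n.-tuple nat := [tuple elem I r | r < n].

Lemma tuple_actM s q t : tuple_act q (tuple_act s t) = tuple_act (q * s)%g t.
Proof. by apply: eq_from_tnth => r; rewrite !tnth_mktuple permM. Qed.

Lemma tuple_act1 t : tuple_act 1 t = t.
Proof. by apply: eq_from_tnth => r; rewrite tnth_mktuple perm1. Qed.

Lemma altext_elems w I s : altext w (tuple_act s (elems I)) = (-1) ^+ s * w I.
Proof.
rewrite -altext_perm; congr altext; apply: eq_from_tnth => r.
by rewrite !tnth_mktuple.
Qed.

Lemma altext_elems1 w I : altext w (elems I) = w I.
Proof. by rewrite -[elems I]tuple_act1 altext_elems odd_perm1 mul1r. Qed.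

Lemma mem_elems I (i : nat) : (i \in elems I) = (i \in val I).
Proof.
by apply/tnthP/mem_elem => -[r ->]; exists r; rewrite ?tnth_mktuple.
Qed.

Lemma uniq_elems I : uniq (elems I).
Proof. by apply/tuple_uniqP => r s; rewrite !tnth_mktuple => /elem_inj. Qed.

Lemma uniq_tuple_act s t : uniq (tuple_act s t) = uniq t.
Proof.
have aux q (u : n.-tuple nat) : uniq u -> uniq (tuple_act q u).
  move=> /tuple_uniqP uu; apply/tuple_uniqP => i j.
  by rewrite !tnth_mktuple => /uu/perm_inj.
apply/idP/idP; last exact: aux.
by move=> /(aux s^-1%g); rewrite tuple_actM mulVg tuple_act1.
Qed.

(** Together with [tuple_act_elems_inj] this parametrizes the tuples with distinct entries
    bijectively by a permutation and an [n]-subset. *)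
Lemma uniq_tuple_elems t : uniq t -> exists s I, t = tuple_act s (elems I).
Proof.
move=> ut; have cI : #|` [fset i in tval t]%fset| == n.
  by rewrite card_fseq undup_id// size_tuple.
pose I : nsubset n := Sub [fset i in tval t]%fset cI.
have /tuple_permP[s ts] : perm_eq t (elems I).
  by apply: uniq_perm => // [|i]; rewrite ?uniq_elems// mem_elems SubK !inE.
by exists s, I; apply: val_inj.
Qed.

Lemma tuple_act_elems_inj s q I J :
  tuple_act s (elems I) = tuple_act q (elems J) -> s = q /\ I = J.
Proof.
move=> E.
have mem (x : 'S_n) (K : nsubset n) (i : nat) :
    (i \in tuple_act x (elems K)) = (i \in val K).
  rewrite -mem_elems; apply/tnthP/tnthP => -[r ->].
    by exists (x r); rewrite !tnth_mktuple.
  by exists (x^-1%g r); rewrite !tnth_mktuple permKV.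
have IJ : I = J by apply/val_inj/fsetP => i; rewrite -(mem s) -(mem q) E.
split=> //; move: E; rewrite IJ => E; apply/permP => r.
by apply: (@elem_inj n J); have := congr1 (fun t => tnth t r) E;
  rewrite !tnth_mktuple.
Qed.

Lemma altext_act w s t : altext w (tuple_act s t) = (-1) ^+ s * altext w t.
Proof.
have [/uniq_tuple_elems[q [I ->]]|nut] := boolP (uniq t).
  rewrite tuple_actM !altext_elems mulrA odd_permM.
  by rewrite signr_addb.
by rewrite !altext_nuniq ?mulr0// uniq_tuple_act.
Qed.

(** An alternating function is determined by its values on increasing tuples: reordering multiplies
    it by the sign, and it vanishes on tuples with a repeated entry. *)
Lemma alternating_altext (u : n.-tuple nat -> R[i]) :
  (forall s t, u (tuple_act s t) = (-1) ^+ s * u t) ->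
  altext (u \o elems) = u.
Proof.
move=> ualt; apply/funext => t.
have [/uniq_tuple_elems[q [I ->]]|nut] := boolP (uniq t).
  by rewrite altext_elems ualt.
rewrite altext_nuniq//.
have /injectivePn[i [j ij tij]] : ~~ injectiveb (tnth t).
  by apply: contra nut => /injectiveP tinj; apply/tuple_uniqP.
(* Exchanging the two equal entries fixes [t] and has sign -1; in characteristic 0 this forces
   [u t = 0]. *)
have : u t = - u t.
  have := ualt (tperm i j) t; rewrite odd_tperm ij expr1 mulN1r => <-.
  congr u; apply: eq_from_tnth => r.
  by rewrite tnth_mktuple; case: tpermP => // ->.
by move/eqP; rewrite -addr_eq0 -mulr2n mulrn_eq0/= => /eqP.
Qed.

Lemma altext_linear (c : R[i]) w w' t :
  altext (fun I => c * w I + w' I) t = c * altext w t + altext w' t.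
Proof.
have [/uniq_tuple_elems[q [I ->]]|nut] := boolP (uniq t).
  by rewrite !altext_elems mulrDr mulrCA.
by rewrite !altext_nuniq// mulr0 addr0.
Qed.

Context {p : R} (hp : 1 <= p).

(** Tuples with a repeated entry contribute nothing; the others are the [n!] orderings of each
    subset, on which the value changes only by a sign. *)
Lemma lpe_altext w : lpe (p := p) (altext w) = (n`!%:R%:E * lpe (p := p) w)%E.
Proof.
have pos (z : R[i]) : (0 <= (cmod z `^ p)%:E)%E by rewrite lee_fin powR_ge0.
rewrite /lpe (@esumID R _ [set t : n.-tuple nat | uniq t] _ _
  (fun t _ => pos (altext w t))) !setTI.
rewrite [X in (_ + X)%E]esum1 ?adde0; last first.
  move=> t /= /negP nut; rewrite altext_nuniq//.
  by rewrite ComplexField.Normc.normc0 powR0// exponent_neq0.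
rewrite (@reindex_esum R _ _ [set: 'S_n * nsubset n] _
  (fun z => tuple_act z.1 (elems z.2))); last first.
  split=> [z _ /=|[s I] [q J] _ _ /= /tuple_act_elems_inj[-> ->]//|t /=].
    by rewrite uniq_tuple_act uniq_elems.
  by move=> /uniq_tuple_elems[s [I ->]]; exists (s, I).
rewrite (@esum_pair R _ _
  (fun s I => (cmod (altext w (tuple_act s (elems I))) `^ p)%:E))//.
have E s : (\esum_(I in [set: nsubset n])
    (cmod (altext w (tuple_act s (elems I))) `^ p)%:E)%E = lpe (p := p) w.
  apply: eq_esum => I _; rewrite altext_elems ComplexField.Normc.normcM.
  rewrite (_ : cmod _ = 1) ?mul1r//; case: (odd_perm s).
    by rewrite expr1 cmodN ComplexField.Normc.normc1.
  by rewrite expr0 ComplexField.Normc.normc1.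
under eq_esum do rewrite E.
rewrite esum_fset; [|exact: finite_finset|by move=> *; exact: lpe_ge0].
rewrite (_ : [set: 'S_n] = [set` enum 'S_n]); last first.
  by apply/seteqP; split=> s //= _; rewrite mem_enum.
by rewrite -fsbig_seq ?enum_uniq// big_enum/= sumr_const card_Sn mule_natl.
Qed.

Local Notation norm_const := (n`!%:R `^ p^-1 : R).

Lemma norm_const_gt0 : 0 < norm_const.
Proof. by rewrite powR_gt0// ltr0n fact_gt0. Qed.

Lemma lpnorme_altext (w : lp hp (nsubset n)) :
  lpnorme p (altext w) = (norm_const * lpnorm w)%:E.
Proof.
rewrite lpnormeE lpe_altext lpe_lp -EFinM poweR_EFin powRM ?powR_ge0//.
by rewrite powRK// lpnorm_ge0.
Qed.

Fact altlp_subproof (w : lp hp (nsubset n)) :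
  altext w \in lp_pred hp (I := n.-tuple nat).
Proof. by rewrite inE lpnorme_altext ltry. Qed.

Definition altlp (w : lp hp (nsubset n)) : lp hp (n.-tuple nat) :=
  Lp (altlp_subproof w).

Lemma lpnorm_altlp (w : lp hp (nsubset n)) :
  lpnorm (altlp w) = norm_const * lpnorm w.
Proof. by rewrite /lpnorm lpnorme_altext. Qed.

Lemma tuple_normE (w : lp hp (nsubset n)) :
  tuple_norm w = norm_const * lpnorm w.
Proof. by rewrite /tuple_norm lpnorme_altext. Qed.

Lemma wedge_act (v : 'I_n -> lp hp nat) s t :
  \det (\matrix_(r, k) v r (tnth (tuple_act s t) k)) =
  (-1) ^+ s * \det (\matrix_(r, k) v r (tnth t k)).
Proof.
set M := \matrix_(r, k) v r (tnth t k).
rewrite (_ : \matrix_(_, _) _ = col_perm s M); last first.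
  by apply/matrixP => i j; rewrite !mxE tnth_mktuple.
by rewrite col_permE det_mulmx det_perm odd_permV mulrC.
Qed.

(** A determinant alternates in its columns, so [alternating_altext] recovers it from the increasing
    tuples. *)
Lemma altext_wedge (v : 'I_n -> lp hp nat) t :
  altext (wedge v) t = \det (\matrix_(r, k) v r (tnth t k)).
Proof.
rewrite -[RHS](congr1 (fun f => f t) (alternating_altext (wedge_act v))).
congr altext; apply/funext => I /=; congr (\det _).
by apply/matrixP => i j; rewrite !mxE tnth_mktuple.
Qed.

(** The Leibniz formula for the transposed matrix, so that the permutation moves the vectors. It
    links wedges to elementary tensors. *)
Lemma altlp_wedge (v : 'I_n -> lp hp nat) :
  altlp (wedge v) = \sum_(s : 'S_n) (-1) ^+ s *: tens (v \o s).
Proof.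
apply: lpE => t; rewrite lp_sum [LHS]altext_wedge -det_tr.
apply: eq_bigr => s _; rewrite lpZ; congr (_ * _).
by apply: eq_bigr => r _; rewrite !mxE.
Qed.

End AlternatingExtension.

(* The rank of the first [N] columns stabilizes at some [N]; beyond it the
   row relations do not change, so that by independence there is none. *)
Lemma independent_minor (F : fieldType) (n : nat) (a : 'I_n -> nat -> F) :
  (forall c : 'I_n -> F, (forall j, \sum_r c r * a r j = 0) ->
    forall r, c r = 0) ->
  exists t : n.-tuple nat, \det (\matrix_(r, s) a r (tnth t s)) != 0.
Proof.
move=> indep; pose M N : 'M[F]_(n, N) := \matrix_(r, s) a r s.
pose P k := `[< exists N, \rank (M N) = k >].
have exP : exists k, P k by exists (\rank (M 0%N)); apply/asboolP; exists 0%N.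
have Pn k : P k -> (k <= n)%N by move=> /asboolP[N <-]; exact: rank_leq_row.
have [k /asboolP[N rN] kmax] := ex_maxnP exP Pn.
have kerS N' : (N <= N')%N -> (kermx (M N') <= kermx (M N))%MS.
  move=> NN'; apply/sub_kermxP/matrixP => i j.
  have /matrixP/(_ i (widen_ord NN' j)) := mulmx_ker (M N').
  rewrite !mxE => E; rewrite -[RHS]E.
  by apply: eq_bigr => q _; rewrite !mxE.
have kerE N' : (N <= N')%N -> (kermx (M N) <= kermx (M N'))%MS.
  (* The inclusion [kerS] is between spaces of equal dimension, because the rank is already maximal
     at [N]. *)
  move=> NN'; have [_ <-] := mxrank_leqif_sup (kerS _ NN').
  rewrite eqn_leq mxrankS ?kerS//= !mxrank_ker leq_sub2l// rN.
  by apply: kmax; apply/asboolP; exists N'.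
have ker0 : kermx (M N) = 0.
  apply/row_matrixP => i; rewrite row0; apply/rowP => r; rewrite [RHS]mxE.
  apply: (indep (fun r => row i (kermx (M N)) 0 r)) => j.
  have le1 : (N <= maxn N j.+1)%N by rewrite leq_maxl.
  have le2 : (j < maxn N j.+1)%N by rewrite leq_maxr.
  have /sub_kermxP/rowP/(_ (Ordinal le2)) :
      (row i (kermx (M N)) <= kermx (M (maxn N j.+1)))%MS.
    exact: submx_trans (row_sub _ _) (kerE _ le1).
  rewrite !mxE => E; rewrite -[RHS]E.
  by apply: eq_bigr => q _; rewrite !mxE.
(* The rows are independent, so some [n] of the [N] columns form an invertible matrix; their indices
   are the entries of the tuple. *)
have full : row_full (M N)^T.
  by rewrite /row_full mxrank_tr -/(row_free (M N)) -kermx_eq0 ker0.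
exists [tuple (fullrankfun full r : nat) | r < n].
have := fullrowsub_unit full; rewrite unitmxE unitfE -det_tr.
congr (\det _ != 0); apply/matrixP => i j.
by rewrite !mxE tnth_mktuple.
Qed.

(** * Exterior powers of operators and the Pluecker map *)

Section ExteriorPower.
Context {R : realType} {p : R} (hp : 1 <= p) {n : nat}.

Lemma wedgeE (v : 'I_n -> lp hp nat) (I : nsubset n) :
  wedge v I = \det (\matrix_(r, s) v r (elem I s)).
Proof. by []. Qed.

(** Basis vectors are wedges, so density applies to exterior powers as it does to tensors. *)
Lemma delta_wedge (I : nsubset n) :
  lpdelta hp I = wedge (fun s => lpdelta hp (elem I s)).
Proof.
apply: lpE => J; rewrite lpdeltaE wedgeE; case: eqP => [->|JI].
  rewrite [X in \det X](_ : _ = 1%:M) ?det1//.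
  apply/matrixP => r s.
  by rewrite !mxE lpdeltaE (inj_eq (@elem_inj n I)) eq_sym.
(* As [I] and [J] have the same size, some element of [I] lies outside [J]; its row of the matrix
   vanishes. *)
have [r rJ] : exists r, elem I r \notin val J.
  apply/existsP; apply: contra_notT JI => /existsPn IJ.
  apply/esym/val_inj/eqP; rewrite eqEfcard.
  have /eqP -> := valP I; have /eqP -> := valP J; rewrite leqnn andbT.
  by apply/fsubsetP => i /mem_elem[s ->]; apply/negPn/IJ.
rewrite (expand_det_row _ r) big1// => s _; rewrite mxE lpdeltaE.
rewrite (_ : (_ == _) = false) ?mul0r//.
by apply: contraNF rJ => /eqP <-; apply/mem_elem; exists s.
Qed.

Lemma ext_power_uniq (T : lp hp nat -> lp hp nat)
    (L L' : {linear lp hp (nsubset n) -> lp hp (nsubset n)}) :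
  ext_power T L -> ext_power T L' -> L' =1 L.
Proof.
move=> [bL LT] [bL' LT']; apply: bounded_linear_eq => // I.
by rewrite delta_wedge LT LT'.
Qed.

Lemma act_lp_subproof (s : 'S_n) (u : lp hp (n.-tuple nat)) :
  u \o tuple_act s \in lp_pred hp (I := n.-tuple nat).
Proof.
rewrite inE; apply: (lpmem_inj hp); last exact: lpvalP.
apply: (can_inj (g := tuple_act s^-1%g)) => t.
by rewrite tuple_actM mulVg tuple_act1.
Qed.

Definition act_lp s u : lp hp (n.-tuple nat) := Lp (act_lp_subproof s u).

Lemma lpnorm_act s u : lpnorm (act_lp s u) = lpnorm u.
Proof.
rewrite /lpnorm !lpnormeE /lpe [in RHS](esum_bij (e := tuple_act s))//.
by exists (tuple_act s^-1%g) => t; rewrite tuple_actM ?mulVg ?mulgV tuple_act1.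
Qed.

Lemma act_tens s (x : 'I_n -> lp hp nat) :
  act_lp s (tens x) = tens (x \o s^-1%g).
Proof.
apply: lpE => t /=; rewrite (reindex_inj (@perm_inj _ s^-1%g))/=.
by apply: eq_bigr => r _; rewrite tnth_mktuple permKV.
Qed.

(** Both composites are bounded, and they agree on elementary tensors because the same [T] acts on
    every factor. *)
Lemma tensor_op_act (T : lp hp nat -> lp hp nat)
    (S : {linear lp hp (n.-tuple nat) -> lp hp (n.-tuple nat)}) s u :
  tensor_op (fun _ : 'I_n => T) S -> S (act_lp s u) = act_lp s (S u).
Proof.
move=> [bS ST].
have N0 := @lpnorm_ge0 R p hp (n.-tuple nat).
have [P PE] : exists P : {linear lp hp (n.-tuple nat) -> lp hp (n.-tuple nat)},
    P =1 act_lp s by apply: ex_linear => c x y; exact: lpE.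
rewrite -!PE; move: u.
apply: (@bounded_linear_eq _ _ _ _ _ (S \o P) (P \o S)).
- exists (opnorm lpnorm lpnorm S) => u; apply: le_trans (opnormP N0 bS _) _.
  by rewrite PE lpnorm_act.
- exists (opnorm lpnorm lpnorm S) => u.
  by rewrite /= PE lpnorm_act opnormP.
by move=> t; rewrite /= delta_tens !PE act_tens !ST act_tens.
Qed.

(** [L w] consists of the values of [S (altlp w)] on increasing tuples. Since [S (altlp w)] is
    alternating, it is [altlp (L w)], and the bound for [S] becomes one for [L]. *)
Lemma ex_ext_power (T : {linear lp hp nat -> lp hp nat}) :
  op_bounded lpnorm lpnorm T ->
  exists L : {linear lp hp (nsubset n) -> lp hp (nsubset n)},
    ext_power T L
    /\ forall w, lpnorm (L w) <= opnorm lpnorm lpnorm T ^+ n * lpnorm w.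
Proof.
move=> bT; have [S [St _ bS]] := ex_tensor_op (fun _ : 'I_n => bT).
have elems_inj : injective (@elems n).
  move=> I J IJ; have [] // := @tuple_act_elems_inj n 1%g 1%g I J.
  by rewrite IJ.
have mem (w : lp hp (nsubset n)) :
    S (altlp w) \o @elems n \in lp_pred hp (I := nsubset n).
  by rewrite inE; apply: (lpmem_inj hp) => //; exact: lpvalP.
have [L LE] : exists L : {linear lp hp (nsubset n) -> lp hp (nsubset n)},
    L =1 (fun w => Lp (mem w)).
  apply: ex_linear => c u v; apply: lpE => I /=.
  have -> : altlp (c *: u + v) = c *: altlp u + altlp v.
    by apply: lpE => t; exact: (altext_linear c u v t).
  by rewrite linearP.
(* [S] commutes with the action of the symmetric group, hence preserves
   alternating functions. *)
have SE w : S (altlp w) = altlp (L w).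
  apply: lpE => t; rewrite /= LE alternating_altext// => s {}t.
  rewrite -[LHS]/(act_lp s (S (altlp w)) t) -(tensor_op_act _ _ St).
  rewrite (_ : act_lp s (altlp w) = (-1) ^+ s *: altlp w) ?linearZ//.
  by apply: lpE => t'; exact: altext_act.
have bL w : lpnorm (L w) <= opnorm lpnorm lpnorm T ^+ n * lpnorm w.
  (* Both sides carry the same positive factor, the [p]-th root of [n!], which is cancelled. *)
  have := bS (altlp w); rewrite SE !lpnorm_altlp prodr_const card_ord.
  by rewrite mulrCA ler_pM2l// norm_const_gt0.
exists L; split=> //; split; first by exists (opnorm lpnorm lpnorm T ^+ n).
move=> v; apply: lpE => I; rewrite LE /= altlp_wedge linear_sum.
have -> : \sum_(s : 'S_n) S ((-1) ^+ s *: tens (v \o s)) =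
    altlp (wedge (fun r => T (v r))).
  by rewrite altlp_wedge; apply: eq_bigr => s _; rewrite linearZ/= St.2.
exact: altext_elems1.
Qed.

(** Multiplicativity of the determinant, minor by minor. It makes the Pluecker class independent of
    the basis. *)
Lemma wedge_lincomb (v v' : 'I_n -> lp hp nat) (C : 'M[R[i]]_n) :
  (forall r, v' r = \sum_q C r q *: v q) -> wedge v' = \det C *: wedge v.
Proof.
move=> v'E; apply: lpE => I; rewrite lpZ /= -det_mulmx; congr (\det _).
apply/matrixP => r s; rewrite !mxE v'E lp_sum.
by apply: eq_bigr => q _; rewrite lpZ mxE.
Qed.

(** A nonzero minor along an arbitrary tuple is a value of the alternating extension of [wedge v],
    which would vanish with [wedge v]. *)
Lemma wedge_neq0 (v : 'I_n -> lp hp nat) :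
  (forall c : 'I_n -> R[i], \sum_r c r *: v r = 0 -> forall r, c r = 0) ->
  wedge v != 0.
Proof.
move=> indep; have [c cv|t] := @independent_minor R[i] n v.
  by apply: indep; apply: lpE => j; rewrite lp_sum; exact: cv.
rewrite -altext_wedge; apply: contra_neq => ->; rewrite /altext.
by case: insub => // J; rewrite big1// => s _; rewrite lp0 mulr0.
Qed.

Lemma plucker_basis (V : set (lp hp nat)) (v : 'I_n -> lp hp nat) :
  is_basis V v -> wedge v != 0 /\ plucker n V = proj_class (wedge v).
Proof.
move=> [indep VE]; split; first exact: wedge_neq0.
apply/seteqP; split=> [u [v' [_ VE'] [c ->]]|u vu]; last by exists v.
have /choice[C CE] r : exists c : 'I_n -> R[i], v' r = \sum_q c q *: v q.
  have : lin_span v' (v' r).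
    exists (fun q => (q == r)%:R); rewrite (bigD1 r)//= eqxx scale1r.
    by rewrite big1 ?addr0// => q /negPf ->; rewrite scale0r.
  by rewrite -VE' VE.
exists (c * \det (\matrix_(r, q) C r q)).
rewrite -scalerA -(@wedge_lincomb v v')// => r; rewrite CE.
by apply: eq_bigr => q _; rewrite mxE.
Qed.

Lemma ext_power_id (L : {linear lp hp (nsubset n) -> lp hp (nsubset n)}) :
  ext_power id L -> L =1 id.
Proof.
move=> LP.
have [I IE] : exists I : {linear lp hp (nsubset n) -> lp hp (nsubset n)},
    I =1 id by exact: ex_linear.
move=> w; rewrite -[RHS]IE; apply: (ext_power_uniq (T := id)) => //.
split=> [|v]; last by rewrite IE.
by exists 1 => x; rewrite IE mul1r.
Qed.

Lemma ext_power_comp (T1 T2 : lp hp nat -> lp hp nat)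
    (L1 L2 : {linear lp hp (nsubset n) -> lp hp (nsubset n)}) :
  ext_power T1 L1 -> ext_power T2 L2 -> ext_power (T1 \o T2) (L1 \o L2).
Proof.
move=> [b1 E1] [b2 E2]; have N0 := @lpnorm_ge0 R p hp (nsubset n).
split=> [|v /=]; last by rewrite E2 E1.
exists (opnorm lpnorm lpnorm L1 * opnorm lpnorm lpnorm L2) => w.
apply: le_trans (opnormP N0 b1 _) _; rewrite -mulrA.
by rewrite ler_wpM2l ?opnorm_ge0// opnormP.
Qed.

(** By uniqueness [L] is the operator constructed in [ex_ext_power]. *)
Lemma ext_power_bound (T : {linear lp hp nat -> lp hp nat})
    (L : {linear lp hp (nsubset n) -> lp hp (nsubset n)}) :
  op_bounded lpnorm lpnorm T -> ext_power T L ->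
  forall w, lpnorm (L w) <= opnorm lpnorm lpnorm T ^+ n * lpnorm w.
Proof.
move=> bT LT w; have [L0 [L0T b0]] := ex_ext_power bT.
by rewrite (ext_power_uniq L0T LT).
Qed.

Lemma opnorm_ext_power (T : {linear lp hp nat -> lp hp nat})
    (L : {linear lp hp (nsubset n) -> lp hp (nsubset n)}) :
  op_bounded lpnorm lpnorm T -> ext_power T L ->
  opnorm lpnorm lpnorm L <= opnorm lpnorm lpnorm T ^+ n.
Proof.
move=> bT LT; apply: opnorm_le; last exact: ext_power_bound.
by rewrite exprn_ge0// opnorm_ge0//; exact: lpnorm_ge0.
Qed.

(** [L' \o L] is an exterior power of [h \o g], which is the identity. *)
Lemma ext_power_cancel (g h : lp hp nat -> lp hp nat)
    (L L' : {linear lp hp (nsubset n) -> lp hp (nsubset n)}) :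
  cancel g h -> ext_power g L -> ext_power h L' -> cancel L L'.
Proof.
move=> gK gL hL' w; apply: (@ext_power_id (L' \o L)).
have := ext_power_comp hL' gL; congr ext_power; exact/funext.
Qed.

Lemma basis_image (g h : {linear lp hp nat -> lp hp nat})
    (V : set (lp hp nat)) (v : 'I_n -> lp hp nat) :
  cancel g h -> is_basis V v -> is_basis (g @` V) (g \o v).
Proof.
move=> gK [indep ->]; split=> [c|].
  have -> : \sum_r c r *: (g \o v) r = g (\sum_r c r *: v r).
    by rewrite linear_sum; apply: eq_bigr => r _; rewrite linearZ.
  by move=> E; apply: indep; apply: (can_inj gK); rewrite E linear0.
apply/seteqP; split=> [_ [_ [c ->] <-]|_ [c ->]].
  by exists c; rewrite linear_sum; apply: eq_bigr => r _; rewrite linearZ.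
exists (\sum_r c r *: v r); first by exists c.
by rewrite linear_sum; apply: eq_bigr => r _; rewrite linearZ.
Qed.

(** A basis of [V] is carried by [g] to a basis of the image, and its wedge by [L] to the wedge of
    that basis. *)
Lemma plucker_equivariant (g h : {linear lp hp nat -> lp hp nat})
    (L : {linear lp hp (nsubset n) -> lp hp (nsubset n)})
    (V : set (lp hp nat)) :
  cancel g h -> ext_power g L -> has_dim n V ->
  has_dim n (g @` V) /\ plucker n (g @` V) = L @` plucker n V.
Proof.
move=> gK [_ gL] [v Vv]; have gVv := basis_image gK Vv.
split; first by exists (g \o v).
have [_ ->] := plucker_basis gVv; have [_ ->] := plucker_basis Vv.
rewrite -gL; apply/seteqP; split=> [_ [c ->]|_ [_ [c ->] <-]].
  by exists (c *: wedge v); [exists c|rewrite linearZ].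
by exists c; rewrite linearZ.
Qed.

End ExteriorPower.

Theorem proposition5p1 (R : realType) (p : R) (hp : 1 <= p) (n : nat)
    (hn : (1 <= n)%N) :
  (* l^p(N^(m+1)) = l^p(N; l^p(N^m)) isometrically *)
  (forall (m : nat) (u : m.+1.-tuple nat -> R[i]),
     lpnorme p u =
     lpsum p (fun j : nat =>
       lpnorme p (fun t : m.-tuple nat => u [tuple of j :: t])))
  /\
  (* T_1 (x) ... (x) T_n *)
  (forall T : 'I_n -> {linear lp hp nat -> lp hp nat},
     (forall r, op_bounded lpnorm lpnorm (T r)) ->
     exists S : {linear lp hp (n.-tuple nat) -> lp hp (n.-tuple nat)},
       [/\ tensor_op T S,
           forall S' : {linear lp hp (n.-tuple nat) -> lp hp (n.-tuple nat)},
             tensor_op T S' -> S' =1 S,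
           exists A : 'I_n ->
               {linear lp hp (n.-tuple nat) -> lp hp (n.-tuple nat)},
             (forall k,
                [/\ slicewise k (T k) (A k),
                    op_bounded lpnorm lpnorm (A k)
                  & opnorm lpnorm lpnorm (A k) <= opnorm lpnorm lpnorm (T k)])
             /\ (forall u, S u = foldr (fun k => A k) u (enum 'I_n))
         & opnorm lpnorm lpnorm S <= \prod_r opnorm lpnorm lpnorm (T r)])
  /\
  (* uniform reasonable crossnorm, exact on elementary tensors *)
  [/\ reasonable_crossnorm (@coord_norm R p hp n),
      uniform_norm (@coord_norm R p hp n)
    & forall x y : lp hp nat,
        lpnorme p (fun ij : nat * nat => x ij.1 * y ij.2) =
        (lpnorm x * lpnorm y)%:E]
  /\
  (* subset- versus tuple-indexing, and the bound for the exterior power *)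
  ((forall w : lp hp (nsubset n),
      lpnorme p (altext w) = ((n`!%:R `^ p^-1) * lpnorm w)%:E)
   /\
   (forall T : {linear lp hp nat -> lp hp nat},
      op_bounded lpnorm lpnorm T ->
      exists L : {linear lp hp (nsubset n) -> lp hp (nsubset n)},
        [/\ ext_power T L,
            forall L' : {linear lp hp (nsubset n) -> lp hp (nsubset n)},
              ext_power T L' -> L' =1 L,
            opnorm lpnorm lpnorm L <= opnorm lpnorm lpnorm T ^+ n,
            op_bounded tuple_norm tuple_norm L
          & opnorm tuple_norm tuple_norm L
              <= opnorm lpnorm lpnorm T ^+ n]))
  /\
  (* the Pluecker map is well defined *)
  (forall (V : set (lp hp nat)) (v : 'I_n -> lp hp nat),
     is_basis V v -> wedge v != 0 /\ plucker n V = proj_class (wedge v))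
  /\
  (* g |-> Lambda^n g is multiplicative *)
  ((forall L : {linear lp hp (nsubset n) -> lp hp (nsubset n)},
      ext_power id L -> L =1 id)
   /\
   (forall (T1 T2 : {linear lp hp nat -> lp hp nat})
      (L1 L2 L12 : {linear lp hp (nsubset n) -> lp hp (nsubset n)}),
      op_bounded lpnorm lpnorm T1 -> op_bounded lpnorm lpnorm T2 ->
      ext_power T1 L1 -> ext_power T2 L2 -> ext_power (T1 \o T2) L12 ->
      L12 =1 L1 \o L2))
  /\
  (* GL(l^p)-equivariance of the Pluecker map, with norm control *)
  (forall (g h : {linear lp hp nat -> lp hp nat})
     (L L' : {linear lp hp (nsubset n) -> lp hp (nsubset n)}),
     op_bounded lpnorm lpnorm g -> op_bounded lpnorm lpnorm h ->
     cancel g h -> cancel h g -> ext_power g L -> ext_power h L' ->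
     [/\ cancel L L', cancel L' L,
         opnorm lpnorm lpnorm L <= opnorm lpnorm lpnorm g ^+ n,
         opnorm lpnorm lpnorm L' <= opnorm lpnorm lpnorm h ^+ n
       & forall V : set (lp hp nat), has_dim n V ->
           has_dim n (g @` V) /\ plucker n (g @` V) = L @` plucker n V]).
Proof.
have N0 (I : choiceType) := @lpnorm_ge0 R p hp I.
split; first by move=> m u; exact: lpnorme_cons.
split.
  move=> T bT; have [S [TS AS bS]] := ex_tensor_op bT.
  exists S; split=> // [S' TS'|]; first exact: tensor_op_uniq TS TS'.
  apply: opnorm_le => //; apply: prodr_ge0 => r _; exact: opnorm_ge0.
split.
  split; [exact: coord_reasonable|exact: coord_uniform|exact: lpnorme_tensor].
split.
  split=> [w|T bT]; first exact: lpnorme_altext.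
  have [L [LT bL]] := ex_ext_power (n := n) bT.
  have T0 : 0 <= opnorm lpnorm lpnorm T ^+ n by rewrite exprn_ge0// opnorm_ge0.
  have btL w : tuple_norm (L w) <= opnorm lpnorm lpnorm T ^+ n * tuple_norm w.
    by rewrite !tuple_normE mulrCA ler_wpM2l// ltW// norm_const_gt0.
  exists L; split=> // [L' LT'|||].
  - exact: ext_power_uniq LT LT'.
  - exact: opnorm_le.
  - by exists (opnorm lpnorm lpnorm T ^+ n).
  - exact: opnorm_le.
split; first by move=> V v; exact: plucker_basis.
split.
  split=> [L|T1 T2 L1 L2 L12 b1 b2 P1 P2 P12]; first exact: ext_power_id.
  (* Both [L12] and [L1 \o L2] are exterior powers of [T1 \o T2]. *)
  exact: (@ext_power_uniq _ _ _ _ _ (L1 \o L2) L12 (ext_power_comp P1 P2) P12).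
move=> g h L L' bg bh gK hK gL hL'; split.
- exact: ext_power_cancel gK gL hL'.
- exact: ext_power_cancel hK hL' gL.
- exact: opnorm_ext_power.
- exact: opnorm_ext_power.
- by move=> V; exact: (plucker_equivariant gK gL).
Qed.
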